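(* Let $H$ be a coquasi-Hopf algebra with bijective antipode, $A$ a right $H$-comodule algebra and $B=A^{coH}$. Assume that (1) there exists a total integral $\gamma:H\to A$; (2) the canonical map $can:A\otimes_BA\to A\otimes H$ is surjective. Then the functor of coinvariants $(-)^{coH}$ and the induction functor $(-)\otimes_BA$ form a pair of inverse equivalences between $\mathcal{M}_A^H$ and $\mathcal{M}_B$.
   Context: Everything is over a field $k$; $\otimes=\otimes_k$. Sweedler notation: $\Delta(h)=h_1\otimes h_2$ (summation suppressed); for a right comodule, $\rho(m)=m_0\otimes m_1$, iterated as $m_0\otimes m_1\otimes m_2$, etc. A coquasi-bialgebra is a coassociative counital coalgebra $(H,\Delta,\varepsilon)$ with coalgebra morphisms $H\otimes H\to H$, $h\otimes g\mapsto hg$, and $k\to H$, $1\mapsto 1_H$, and a convolution invertible $\omega\in(H\otimes H\otimes H)^*$ such that for all $h,g,x,y\in H$: $h_1(g_1x_1)\omega(h_2,g_2,x_2)=\omega(h_1,g_1,x_1)(h_2g_2)x_2$; $1_Hh=h1_H=h$; $\omega(h_1,g_1,x_1y_1)\omega(h_2g_2,x_2,y_2)=\omega(g_1,x_1,y_1)\omega(h_1,g_2x_2,y_2)\omega(h_2,g_3,x_3)$; $\omega(h,1_H,g)=\varepsilon(h)\varepsilon(g)$. A coquasi-Hopf algebra is a coquasi-bialgebra with a coalgebra antihomomorphism $S:H\to H$ (antipode) and $\alpha,\beta\in H^*$ such that $S(h_1)\alpha(h_2)h_3=\alpha(h)1_H$, $h_1\beta(h_2)S(h_3)=\beta(h)1_H$,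 $\omega(h_1\beta(h_2),S(h_3),\alpha(h_4)h_5)=\omega^{-1}(S(h_1),\alpha(h_2)h_3\beta(h_4),S(h_5))=\varepsilon(h)$. The triple $(S,\alpha,\beta)$ is fixed and normalized by $\alpha(1_H)=\beta(1_H)=1$. A right $H$-comodule algebra is a right $H$-comodule $A$ with a multiplication and an element $1_A$ such that $\rho(ab)=a_0b_0\otimes a_1b_1$, $\rho(1_A)=1_A\otimes 1_H$, $1_Aa=a=a1_A$, $(ab)c=a_0(b_0c_0)\omega(a_1,b_1,c_1)$. $B=A^{coH}=\{a\in A:\rho(a)=a\otimes 1_H\}$ is an associative unital algebra, and $A$ is a $B$-bimodule by multiplication. $\mathcal{M}_A^H$ (right relative Hopf modules): right $H$-comodules $M$ with a right action $M\otimes A\to M$ satisfying $\rho(ma)=m_0a_0\otimes m_1a_1$, $m1_A=m$, $(ma)b=m_0(a_0b_0)\omega(m_1,a_1,b_1)$; morphisms are the $H$-colinear maps respecting the action. $M^{coH}=\{m:\rho(m)=m\otimes1_H\}$ is a right $B$-module. For $N\in\mathcal{M}_B$ (right $B$-modules), $N\otimes_BA\in\mathcal{M}_A^H$ by $\rho(n\otimes_Ba)=n\otimes_Ba_0\otimes a_1$, $(n\otimes_Ba)b=n\otimes_Bab$. The functor $(-)\otimes_BA$ is left adjoint to $(-)^{coH}$, with counit $\varepsilon_M(m\otimes_Ba)=ma$ and unit $u_N(n)=n\otimes_B1_A$. The canonical map is $can:A\otimes_BA\to A\otimes H$, $can(a\otimes_Bb)=a_0b_0\otimes b_4\,\omega^{-1}(a_1,b_1\beta(b_2),S(b_3))$.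 A total integral is an $H$-colinear map $\gamma:H\to A$ ($H$ a right comodule via $\Delta$) with $\gamma(1_H)=1_A$. *)

(* Defs.v *)
From HB Require Import structures.
From mathcomp Require Import all_boot all_algebra.
From mathcomp Require Import boolp.

Set Implicit Arguments.
Unset Strict Implicit.
Unset Printing Implicit Defensive.

Import GRing.Theory.
Local Open Scope ring_scope.
Local Open Scope quotient_scope.

Section Tensor.
Variables (k : fieldType) (M : zmodType) (N : lmodType k) (I : Type).
Variables (r : I -> M -> M) (l : I -> N -> N).

(* The tensor product of M and N balanced over I (the relations
   (m.i) (x) n = m (x) (i.n)) is the free k-module on M * N modulo the
   submodule generated by biadditivity, k-linearity in N and balancedness.  A
   list stands for the formal sum of its entries, a coefficient c in front of
   (m, n) being absorbed as (m, c n); opposites are scalings by -1.  With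
   I = k this is the usual tensor product over k; with I = B, M a right
   B-module and N a left B-module on which k and B commute, it is the tensor
   product over B, with the k-structure of N. *)
Definition fscale (c : k) (s : seq (M * N)) : seq (M * N) :=
  [seq (p.1, c *: p.2) | p <- s].

Inductive teq : seq (M * N) -> seq (M * N) -> Prop :=
| teq_refl s : teq s s
| teq_sym s t : teq s t -> teq t s
| teq_trans s t u : teq s t -> teq t u -> teq s u
| teq_cat s s' t t' : teq s s' -> teq t t' -> teq (s ++ t) (s' ++ t')
| teq_catC s t : teq (s ++ t) (t ++ s)
| teq_scale c s t : teq s t -> teq (fscale c s) (fscale c t)
| teq_Dl m m' n : teq [:: (m + m', n)] [:: (m, n); (m', n)]
| teq_Dr m n n' : teq [:: (m, n + n')] [:: (m, n); (m, n')]
| teq_0r m : teq [:: (m, 0)] [::]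
| teq_bal i m n : teq [:: (r i m, n)] [:: (m, l i n)].

Definition teqb s t := `[< teq s t >].

Lemma teqb_refl : reflexive teqb.
Proof. by move=> s; apply/asboolP; constructor. Qed.
Lemma teqb_sym : symmetric teqb.
Proof. by move=> s t; apply/asboolP/asboolP; apply: teq_sym. Qed.
Lemma teqb_trans : transitive teqb.
Proof.
by move=> t s u /asboolP st /asboolP tu; apply/asboolP; apply: teq_trans tu.
Qed.

Canonical teq_equiv := EquivRel teqb teqb_refl teqb_sym teqb_trans.

Record tens := Tens { tens_quot : {eq_quot teq_equiv} }.
HB.instance Definition _ := [isNew for tens_quot].
HB.instance Definition _ := [Choice of tens by <:].

Definition tcl (s : seq (M * N)) : tens := Tens (\pi_{eq_quot teq_equiv} s).
Definition trep (t : tens) : seq (M * N) := repr (tens_quot t).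

Lemma tclP s t : tcl s = tcl t <-> teq s t.
Proof.
rewrite /tcl; split; first by case=> /eqmodP/asboolP.
by move=> st; congr Tens; apply/eqmodP/asboolP.
Qed.

Lemma trepK t : tcl (trep t) = t.
Proof. by case: t => t; rewrite /tcl /trep /= reprK. Qed.

Lemma trep_tcl s : teq (trep (tcl s)) s.
Proof. by apply/tclP; rewrite trepK. Qed.

Definition tadd s t := tcl (trep s ++ trep t).
Definition tzero := tcl [::].
Definition tscale c t := tcl (fscale c (trep t)).

Lemma tadd_cl s t : tadd (tcl s) (tcl t) = tcl (s ++ t).
Proof. by apply/tclP; apply: teq_cat; apply: trep_tcl. Qed.
Lemma tscale_cl c s : tscale c (tcl s) = tcl (fscale c s).
Proof. by apply/tclP; apply: teq_scale; apply: trep_tcl. Qed.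

Lemma tcl_ind (P : tens -> Prop) : (forall s, P (tcl s)) -> forall t, P t.
Proof. by move=> Ps t; rewrite -(trepK t). Qed.

Lemma taddA : associative tadd.
Proof.
elim/tcl_ind=> s; elim/tcl_ind=> t; elim/tcl_ind=> u.
by rewrite !tadd_cl catA.
Qed.
Lemma taddC : commutative tadd.
Proof.
by elim/tcl_ind=> s; elim/tcl_ind=> t; rewrite !tadd_cl; apply/tclP/teq_catC.
Qed.
Lemma tadd0 : left_id tzero tadd.
Proof. by elim/tcl_ind=> s; rewrite tadd_cl. Qed.

Lemma tclD s t : tcl (s ++ t) = tadd (tcl s) (tcl t).
Proof. by rewrite tadd_cl. Qed.

Lemma tscaleDl t a b : tscale (a + b) t = tadd (tscale a t) (tscale b t).
Proof.
elim/tcl_ind: t => s; rewrite !tscale_cl tadd_cl.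
elim: s => [//|[m n] s IH] /=.
rewrite -cat1s tclD IH -[X in _ = tcl X]cat1s -tclD.
apply/tclP; apply: (@teq_trans _ ([:: (m, a *: n); (m, b *: n)] ++
   (fscale a s ++ fscale b s))).
  by apply: teq_cat; [rewrite scalerDl; apply: teq_Dr|apply: teq_refl].
rewrite -[X in teq X _]/([:: (m, a *: n)] ++ ([:: (m, b *: n)] ++ (fscale a s ++ fscale b s))).
apply: teq_cat; first exact: teq_refl.
rewrite -[X in teq _ X]/(fscale a s ++ ([:: (m, b *: n)] ++ fscale b s)).
rewrite !catA; apply: teq_cat; [exact: teq_catC|exact: teq_refl].
Qed.

Lemma tscaleDr a s t : tscale a (tadd s t) = tadd (tscale a s) (tscale a t).
Proof.
elim/tcl_ind: s => s; elim/tcl_ind: t => t.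
by rewrite !(tadd_cl, tscale_cl) /fscale map_cat.
Qed.

Lemma tscaleA a b t : tscale a (tscale b t) = tscale (a * b) t.
Proof.
elim/tcl_ind: t => s; rewrite !tscale_cl /fscale -map_comp; congr tcl.
by apply: eq_map => p /=; rewrite scalerA.
Qed.

Lemma tscale1 t : tscale 1 t = t.
Proof.
elim/tcl_ind: t => s; rewrite !tscale_cl /fscale; congr tcl.
by rewrite -[RHS]map_id; apply: eq_map => -[m n] /=; rewrite scale1r.
Qed.

Lemma tscale0 t : tscale 0 t = tzero.
Proof.
elim/tcl_ind: t => s; rewrite tscale_cl; elim: s => [//|[m n] s IH] /=.
rewrite -cat1s tclD IH scale0r /tzero -tclD cats0.
by apply/tclP/teq_0r.
Qed.

Definition topp t := tscale (-1) t.
Lemma taddN : left_inverse tzero topp tadd.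
Proof. by move=> t; rewrite -{2}(tscale1 t) -tscaleDl addNr tscale0. Qed.

HB.instance Definition _ := GRing.isZmodule.Build tens taddA taddC tadd0 taddN.
HB.instance Definition _ := GRing.Zmodule_isLmodule.Build k tens
  tscaleA tscale1 tscaleDr (fun t a b => tscaleDl t a b).

Definition pure (m : M) (n : N) : tens := tcl [:: (m, n)].

(* tsum t f is the sum of the f m_i n_i for a chosen writing of t as a sum of
   the m_i (x) n_i.  For a balanced f (see below) it does not depend on that
   choice: t |-> tsum t f is the unique k-linear map with
   m (x) n |-> f m n (tsum_pure, tsum_is_linear, tens_ext). *)
Definition tsum (W : nmodType) (t : tens) (f : M -> N -> W) : W :=
  \sum_(p <- trep t) f p.1 p.2.

Lemma tcl_sum s : tcl s = \sum_(p <- s) pure p.1 p.2.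
Proof.
elim: s => [|[m n] s IH]; first by rewrite big_nil.
rewrite big_cons -IH -[(m, n) :: s]cat1s tclD; reflexivity.
Qed.

Lemma tsum_pureE t : tsum t pure = t.
Proof. by rewrite /tsum -tcl_sum trepK. Qed.

Lemma pureDl m m' n : pure (m + m') n = pure m n + pure m' n.
Proof. by rewrite /pure -[RHS]tclD; apply/tclP/teq_Dl. Qed.
Lemma pureDr m n n' : pure m (n + n') = pure m n + pure m n'.
Proof. by rewrite /pure -[RHS]tclD; apply/tclP/teq_Dr. Qed.
Lemma pureZr c m n : pure m (c *: n) = c *: pure m n.
Proof. exact: esym (tscale_cl c [:: (m, n)]). Qed.
Lemma pureB i m n : pure (r i m) n = pure m (l i n).
Proof. by apply/tclP/teq_bal. Qed.

Record balanced (W : lmodType k) (f : M -> N -> W) : Prop := Balanced {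
  balDl : forall m m' n, f (m + m') n = f m n + f m' n;
  balDr : forall m n n', f m (n + n') = f m n + f m n';
  balZr : forall c m n, f m (c *: n) = c *: f m n;
  balB : forall i m n, f (r i m) n = f m (l i n) }.

Lemma pure_balanced : balanced pure.
Proof. split; [exact: pureDl|exact: pureDr|exact: pureZr|exact: pureB]. Qed.

Section Lift.
Variables (W : lmodType k) (f : M -> N -> W).
Hypothesis fB : balanced f.

Lemma sum_fscale c s :
  \sum_(p <- fscale c s) f p.1 p.2 = c *: \sum_(p <- s) f p.1 p.2.
Proof.
by rewrite big_map scaler_sumr; apply: eq_bigr => p _; rewrite (balZr fB).
Qed.

Lemma teq_sum s t : teq s t ->
  \sum_(p <- s) f p.1 p.2 = \sum_(p <- t) f p.1 p.2.
Proof.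
elim=> {s t} //.
- by move=> s t u _ -> _ ->.
- by move=> s s' t t' _ es _ et; rewrite !big_cat /= es et.
- by move=> s t; rewrite !big_cat /= addrC.
- by move=> c s t _ IH; rewrite !sum_fscale IH.
- by move=> m m' n; rewrite !(big_cons, big_nil) /= !addr0 (balDl fB).
- by move=> m n n'; rewrite !(big_cons, big_nil) /= !addr0 (balDr fB).
- move=> m; rewrite !(big_cons, big_nil) /= !addr0.
  by rewrite -[X in f m X](scale0r 0) (balZr fB) scale0r.
- by move=> i m n; rewrite !(big_cons, big_nil) /= (balB fB).
Qed.

Lemma tsum_tcl s : tsum (tcl s) f = \sum_(p <- s) f p.1 p.2.
Proof. exact: teq_sum (trep_tcl s). Qed.

Lemma tsum_pure m n : tsum (pure m n) f = f m n.
Proof. by rewrite tsum_tcl big_seq1. Qed.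

Lemma tsum_is_linear : linear (fun t => tsum t f).
Proof.
move=> c; elim/tcl_ind=> s; elim/tcl_ind=> t.
rewrite [_ + _](_ : _ = tcl (fscale c s ++ t)); last first.
  by rewrite -[LHS]/(tadd (tscale c (tcl s)) (tcl t)) tscale_cl tadd_cl.
by rewrite !tsum_tcl big_cat /= sum_fscale.
Qed.

Lemma tsumD t t' : tsum (t + t') f = tsum t f + tsum t' f.
Proof. by have := tsum_is_linear 1 t t'; rewrite !scale1r. Qed.
Lemma tsum0 : tsum 0 f = 0.
Proof. by apply: (addrI (tsum 0 f)); rewrite -tsumD !addr0. Qed.
Lemma tsumZ c t : tsum (c *: t) f = c *: tsum t f.
Proof. by rewrite -[c *: t]addr0 tsum_is_linear tsum0 addr0. Qed.
Lemma tsum_sum J (s : seq J) (F : J -> tens) :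
  tsum (\sum_(j <- s) F j) f = \sum_(j <- s) tsum (F j) f.
Proof. by rewrite (big_morph (fun t => tsum t f) tsumD tsum0). Qed.
End Lift.

Lemma tens_ind (P : tens -> Prop) :
  (forall m n, P (pure m n)) -> (forall s t, P s -> P t -> P (s + t)) ->
  P 0 -> forall t, P t.
Proof.
move=> Pp PD P0 t; rewrite -(tsum_pureE t) /tsum.
by apply: big_rec => // p s _ Ps; apply: PD.
Qed.

Lemma eq_tsum (W : nmodType) t (f g : M -> N -> W) :
  (forall m n, f m n = g m n) -> tsum t f = tsum t g.
Proof. by move=> fg; apply: eq_bigr. Qed.

End Tensor.

Arguments pure {k M N I r l} m n.
Arguments tens {k M N I} r l.

Notation "V \ox W" := (@tens _ V W _ (@GRing.scale _ V) (@GRing.scale _ W))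
  (at level 40, left associativity) : type_scope.
Notation "v \ox w" := (@pure _ _ _ _ (@GRing.scale _ _) (@GRing.scale _ _) v w)
  (at level 40, left associativity) : ring_scope.
Notation "\sw_ ( x , y <- t ) E" := (tsum t (fun x y => E))
  (at level 41, x binder, y binder, t at level 60, E at level 41,
   format "\sw_ ( x ,  y  <-  t )  E") : ring_scope.

Section Multilinear.
Variable k : fieldType.
Implicit Types U V W X : lmodType k.

Definition bilinear U V W (f : U -> V -> W) :=
  (forall v, linear (f^~ v)) /\ (forall u, linear (f u)).

Definition trilinear_form U V X (f : U -> V -> X -> k) :=
  [/\ forall v x, scalar (fun u => f u v x), forall u x, scalar (fun v => f u v x)
    & forall u v, scalar (fun x => f u v x)].

Lemma linP U W (f : U -> W) : linear f <->
  (forall u v, f (u + v) = f u + f v) /\ (forall c u, f (c *: u) = c *: f u).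
Proof.
split=> [lf|[fD fZ] c u v]; last by rewrite fD fZ.
have fD u v : f (u + v) = f u + f v.
  by have := lf 1 u v; rewrite !scale1r.
have f0 : f 0 = 0 by apply: (addrI (f 0)); rewrite -fD !addr0.
by split=> // c u; rewrite -[c *: u]addr0 lf f0 addr0.
Qed.

Section Bil.
Variables (U V W : lmodType k) (f : U -> V -> W).
Hypothesis fB : bilinear f.
Lemma bilDl u u' v : f (u + u') v = f u v + f u' v.
Proof. by have [/(_ v)/linP[]] := fB. Qed.
Lemma bilZl c u v : f (c *: u) v = c *: f u v.
Proof. by have [/(_ v)/linP[_]] := fB. Qed.
Lemma bilDr u v v' : f u (v + v') = f u v + f u v'.
Proof. by have [_ /(_ u)/linP[]] := fB. Qed.
Lemma bilZr c u v : f u (c *: v) = c *: f u v.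
Proof. by have [_ /(_ u)/linP[_]] := fB. Qed.
Lemma bil_balanced :
  balanced (@GRing.scale _ U) (@GRing.scale _ V) f.
Proof.
by split=> *; rewrite ?bilDl ?bilDr ?bilZl ?bilZr.
Qed.
End Bil.

Lemma pure_bilinear U V : bilinear (fun (u : U) (v : V) => u \ox v).
Proof.
split=> [v|u]; apply/linP; split=> *; rewrite ?pureDl ?pureDr ?pureZr //.
by rewrite (pureB (@GRing.scale _ U)) pureZr.
Qed.

Section BalLin.
Variables (M : zmodType) (N : lmodType k) (I : Type).
Variables (r : I -> M -> M) (l : I -> N -> N).
Implicit Type t : tens r l.

Lemma tens_ext W (F G : tens r l -> W) : linear F -> linear G ->
  (forall m n, F (pure m n) = G (pure m n)) -> forall t, F t = G t.
Proof.
move=> /linP[FD FZ] /linP[GD GZ] FG; apply: tens_ind => //.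
  by move=> s t Fs Ft; rewrite FD GD Fs Ft.
by rewrite -(scale0r 0) FZ GZ !scale0r.
Qed.

Lemma tsum_comp_lin W X t (f : M -> N -> W) (g : W -> X) : linear g ->
  g (tsum t f) = tsum t (fun m n => g (f m n)).
Proof.
move=> /linP[gD gZ]; have g0 : g 0 = 0 by rewrite -(scale0r 0) gZ scale0r.
exact: (big_morph g gD g0).
Qed.

Lemma lin_tsum U W t (f : U -> M -> N -> W) :
  (forall m n, linear (fun u => f u m n)) -> linear (fun u => tsum t (f u)).
Proof.
move=> fL c u v; rewrite /tsum scaler_sumr -big_split /=.
by apply: eq_bigr => p _; rewrite fL.
Qed.

Lemma lin_tsum_arg U W (g : U -> tens r l) (f : M -> N -> W) :
  linear g -> balanced r l f -> linear (fun u => tsum (g u) f).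
Proof. by move=> gL fB c u v; rewrite gL (tsum_is_linear fB). Qed.

Lemma lin_pure U (m : M) (g : U -> N) :
  linear g -> linear (fun u => pure m (g u) : tens r l).
Proof. by move=> gL c u v; rewrite gL pureDr pureZr. Qed.

Lemma tsum_tsum W (M' : zmodType) (N' : lmodType k) I'
  (r' : I' -> M' -> M') (l' : I' -> N' -> N') (t : tens r' l')
  (f : M' -> N' -> tens r l) (g : M -> N -> W) : balanced r l g ->
  tsum (tsum t f) g = tsum t (fun m n => tsum (f m n) g).
Proof. by move=> gB; apply: (tsum_sum gB). Qed.
End BalLin.

Lemma lin_id U : linear (fun u : U => u).
Proof. by []. Qed.
Lemma lin_lin U V W (f : {linear V -> W}) (g : U -> V) :
  linear g -> linear (fun u => f (g u)).
Proof. by move=> gL c u v; rewrite gL linearP. Qed.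
Lemma lin_form U V (f : {scalar V}) (g : U -> V) :
  linear g -> linear (fun u => f (g u) : k^o).
Proof. by move=> gL c u v; rewrite gL linearP. Qed.
Lemma lin_bil1 U V V' W (f : V -> V' -> W) (g : U -> V) v' : bilinear f ->
  linear g -> linear (fun u => f (g u) v').
Proof. by case=> fB _ gL c u v; rewrite gL fB. Qed.
Lemma lin_bil2 U V V' W (f : V -> V' -> W) (g : U -> V') v : bilinear f ->
  linear g -> linear (fun u => f v (g u)).
Proof. by case=> _ fB gL c u u'; rewrite gL fB. Qed.
Lemma lin_tri1 U V V' V'' (f : V -> V' -> V'' -> k) (g : U -> V) v' v'' :
  trilinear_form f -> linear g -> linear (fun u => f (g u) v' v'' : k^o).
Proof. by case=> fB _ _ gL c u u'; rewrite gL fB. Qed.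
Lemma lin_tri2 U V V' V'' (f : V -> V' -> V'' -> k) (g : U -> V') v v'' :
  trilinear_form f -> linear g -> linear (fun u => f v (g u) v'' : k^o).
Proof. by case=> _ fB _ gL c u u'; rewrite gL fB. Qed.
Lemma lin_tri3 U V V' V'' (f : V -> V' -> V'' -> k) (g : U -> V'') v v' :
  trilinear_form f -> linear g -> linear (fun u => f v v' (g u) : k^o).
Proof. by case=> _ _ fB gL c u u'; rewrite gL fB. Qed.
Lemma lin_scale1 U W (g : U -> k) (w : W) :
  linear (g : U -> k^o) -> linear (fun u => g u *: w).
Proof. by move=> gL c u v; rewrite gL scalerDl scalerA. Qed.
Lemma lin_scale2 U W (c : k) (g : U -> W) :
  linear g -> linear (fun u => c *: g u).
Proof. by move=> gL d u v; rewrite gL scalerDr !scalerA mulrC. Qed.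
Lemma lin_mul1 U (g : U -> k) (c : k) :
  linear (g : U -> k^o) -> linear (fun u => g u * c : k^o).
Proof. by move=> gL d u v; rewrite gL mulrDl -mulrA. Qed.
Lemma lin_mul2 U (g : U -> k) (c : k) :
  linear (g : U -> k^o) -> linear (fun u => c * g u : k^o).
Proof. by move=> gL d u v; rewrite gL mulrDr [c * _]mulrCA. Qed.
Lemma lin_ox1 U V W (g : U -> V) (w : W) :
  linear g -> linear (fun u => g u \ox w).
Proof. exact: lin_bil1 (pure_bilinear V W). Qed.
End Multilinear.

Section Coalgebra.
Variable k : fieldType.

Record coalgebra := Coalgebra {
  coalg_sort :> lmodType k;
  Delta : {linear coalg_sort -> (coalg_sort \ox coalg_sort)%type};
  counit : {scalar coalg_sort};
  coassoc : forall h,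
    \sw_(x, y <- Delta h) \sw_(x1, x2 <- Delta x) x1 \ox (x2 \ox y) =
    \sw_(x, y <- Delta h) x \ox Delta y;
  counitl : forall h, \sw_(x, y <- Delta h) counit x *: y = h;
  counitr : forall h, \sw_(x, y <- Delta h) counit y *: x = h
}.

Arguments Delta {_}.
Arguments counit {_}.

Record comodule (H : coalgebra) := Comodule {
  comod_sort :> lmodType k;
  rho : {linear comod_sort -> (comod_sort \ox H)%type};
  rho_coassoc : forall v,
    \sw_(x, y <- rho v) \sw_(x0, x1 <- rho x) x0 \ox (x1 \ox y) =
    \sw_(x, y <- rho v) x \ox Delta y;
  rho_counit : forall v, \sw_(x, y <- rho v) counit y *: x = v
}.

Arguments rho {_ _}.

Definition regular_comodule (H : coalgebra) : comodule H :=
  Comodule (@coassoc H) (@counitr H).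

Definition colinear (H : coalgebra) (V W : comodule H) (f : V -> W) :=
  forall v, rho (f v) = \sw_(x, y <- rho v) f x \ox y.

Variables (C : coalgebra) (W : nmodType).
(* Iterated coproducts associate to the right:
   h_1 (x) h_2 (x) h_3 = h_1 (x) (h_2)_1 (x) (h_2)_2, and so on. *)
Definition sw2 (h : C) (f : C -> C -> W) : W := \sw_(h1, h2 <- Delta h) f h1 h2.
Definition sw3 (h : C) (f : C -> C -> C -> W) : W :=
  sw2 h (fun h1 h' => sw2 h' (f h1)).
Definition sw4 (h : C) (f : C -> C -> C -> C -> W) : W :=
  sw2 h (fun h1 h' => sw3 h' (f h1)).
Definition sw5 (h : C) (f : C -> C -> C -> C -> C -> W) : W :=
  sw2 h (fun h1 h' => sw4 h' (f h1)).
End Coalgebra.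

Arguments Delta {_ _}.
Arguments counit {_ _}.
Arguments rho {_ _ _}.

Notation "\Sw_ ( x1 , x2 <- h ) E" := (sw2 h (fun x1 x2 => E))
  (at level 41, x1 binder, x2 binder, h at level 60, E at level 41,
   format "\Sw_ ( x1 ,  x2  <-  h )  E") : ring_scope.
Notation "\Sw_ ( x1 , x2 , x3 <- h ) E" := (sw3 h (fun x1 x2 x3 => E))
  (at level 41, x1 binder, x2 binder, x3 binder, h at level 60, E at level 41,
   format "\Sw_ ( x1 ,  x2 ,  x3  <-  h )  E") : ring_scope.
Notation "\Sw_ ( x1 , x2 , x3 , x4 <- h ) E" := (sw4 h (fun x1 x2 x3 x4 => E))
  (at level 41, x1 binder, x2 binder, x3 binder, x4 binder, h at level 60,
   E at level 41,
   format "\Sw_ ( x1 ,  x2 ,  x3 ,  x4  <-  h )  E") : ring_scope.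
Notation "\Sw_ ( x1 , x2 , x3 , x4 , x5 <- h ) E" :=
  (sw5 h (fun x1 x2 x3 x4 x5 => E))
  (at level 41, x1 binder, x2 binder, x3 binder, x4 binder, x5 binder,
   h at level 60, E at level 41,
   format "\Sw_ ( x1 ,  x2 ,  x3 ,  x4 ,  x5  <-  h )  E") : ring_scope.

Section CoquasiHopf.
Variable k : fieldType.

(* omegaV is the convolution inverse of omega.  Scalar factors attached to an
   argument, such as h_1 beta(h_2), are scalings of that argument. *)
Record coquasi_bialgebra := CoquasiBialgebra {
  cqb_coalg :> coalgebra k;
  hmul : cqb_coalg -> cqb_coalg -> cqb_coalg;
  hone : cqb_coalg;
  omega : cqb_coalg -> cqb_coalg -> cqb_coalg -> k;
  omegaV : cqb_coalg -> cqb_coalg -> cqb_coalg -> k;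
  hmul_bilinear : bilinear hmul;
  omega_trilinear : trilinear_form omega;
  omegaV_trilinear : trilinear_form omegaV;
  Delta_mul : forall h g, Delta (hmul h g) =
    \Sw_(h1, h2 <- h) \Sw_(g1, g2 <- g) hmul h1 g1 \ox hmul h2 g2;
  counit_mul : forall h g, counit (hmul h g) = counit h * counit g;
  Delta1 : Delta hone = hone \ox hone;
  counit1 : counit hone = 1;
  hmul1l : forall h, hmul hone h = h;
  hmul1r : forall h, hmul h hone = h;
  omegaK : forall h g x,
    \Sw_(h1, h2 <- h) \Sw_(g1, g2 <- g) \Sw_(x1, x2 <- x)
      omega h1 g1 x1 * omegaV h2 g2 x2 = counit h * counit g * counit x;
  omegaVK : forall h g x,
    \Sw_(h1, h2 <- h) \Sw_(g1, g2 <- g) \Sw_(x1, x2 <- x)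
      omegaV h1 g1 x1 * omega h2 g2 x2 = counit h * counit g * counit x;
  hmulA : forall h g x,
    \Sw_(h1, h2 <- h) \Sw_(g1, g2 <- g) \Sw_(x1, x2 <- x)
      omega h2 g2 x2 *: hmul h1 (hmul g1 x1) =
    \Sw_(h1, h2 <- h) \Sw_(g1, g2 <- g) \Sw_(x1, x2 <- x)
      omega h1 g1 x1 *: hmul (hmul h2 g2) x2;
  omega_cocycle : forall h g x y,
    \Sw_(h1, h2 <- h) \Sw_(g1, g2 <- g) \Sw_(x1, x2 <- x) \Sw_(y1, y2 <- y)
      omega h1 g1 (hmul x1 y1) * omega (hmul h2 g2) x2 y2 =
    \Sw_(h1, h2 <- h) \Sw_(g1, g2, g3 <- g) \Sw_(x1, x2, x3 <- x)
    \Sw_(y1, y2 <- y)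
      omega g1 x1 y1 * omega h1 (hmul g2 x2) y2 * omega h2 g3 x3;
  omega1 : forall h g, omega h hone g = counit h * counit g
}.

Record coquasi_hopf := CoquasiHopf {
  cqh_bialg :> coquasi_bialgebra;
  antipode : {linear cqh_bialg -> cqh_bialg};
  alpha : {scalar cqh_bialg};
  beta : {scalar cqh_bialg};
  Delta_antipode : forall h, Delta (antipode h) =
    \Sw_(h1, h2 <- h) antipode h2 \ox antipode h1;
  counit_antipode : forall h, counit (antipode h) = counit h;
  antipode_alpha : forall h,
    \Sw_(h1, h2, h3 <- h) hmul (antipode h1) (alpha h2 *: h3) =
    alpha h *: hone cqh_bialg;
  antipode_beta : forall h,
    \Sw_(h1, h2, h3 <- h) hmul (beta h2 *: h1) (antipode h3) =
    beta h *: hone cqh_bialg;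
  omega_antipode : forall h,
    \Sw_(h1, h2, h3, h4, h5 <- h)
      omega (beta h2 *: h1) (antipode h3) (alpha h4 *: h5) = counit h;
  omegaV_antipode : forall h,
    \Sw_(h1, h2, h3, h4, h5 <- h)
      omegaV (antipode h1) ((alpha h2 * beta h4) *: h3) (antipode h5) =
    counit h;
  alpha1 : alpha (hone cqh_bialg) = 1;
  beta1 : beta (hone cqh_bialg) = 1
}.

End CoquasiHopf.

Arguments antipode {_ _}.
Arguments alpha {_ _}.
Arguments beta {_ _}.


Ltac lin :=
  cbv beta; unfold sw5, sw4, sw3, sw2; cbv beta;
  first
  [ exact: lin_id
  | apply lin_tsum; intros ? ?; lin
  | apply lin_tsum_arg; [lin | bal]
  | apply lin_mul1; lin
  | apply lin_mul2; lin
  | apply lin_ox1; lin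
  | apply lin_pure; lin
  | apply lin_scale1; lin
  | apply lin_scale2; lin
  | apply lin_bil1; [by eauto with bilin | lin]
  | apply lin_bil2; [by eauto with bilin | lin]
  | apply lin_tri1; [by eauto with bilin | lin]
  | apply lin_tri2; [by eauto with bilin | lin]
  | apply lin_tri3; [by eauto with bilin | lin]
  | apply lin_form; lin
  | apply lin_lin; lin ]
with bal := first
  [ exact: pure_balanced
  | apply: bil_balanced; split; intros ?; lin
  | by eauto with bilin ].

Create HintDb bilin.
#[global] Hint Resolve hmul_bilinear omega_trilinear omegaV_trilinear : bilin.

Section CoquasiBialgTheory.
Variables (k : fieldType).

Lemma tsum_exch (M M' : zmodType) (N N' : lmodType k) I I'
    (r : I -> M -> M) (l : I -> N -> N) (r' : I' -> M' -> M')
    (l' : I' -> N' -> N') (W : nmodType) (t : tens r l) (t' : tens r' l')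
    (F : M -> N -> M' -> N' -> W) :
  \sw_(x, y <- t) \sw_(x', y' <- t') F x y x' y' =
  \sw_(x', y' <- t') \sw_(x, y <- t) F x y x' y'.
Proof. exact: exchange_big. Qed.

Lemma rho_coassocE (H : coalgebra k) (V : comodule H) (W : lmodType k)
    (f : V -> H -> H -> W) v :
  (forall y z, linear (fun x => f x y z)) ->
  (forall x z, linear (fun y => f x y z)) ->
  (forall x y, linear (fun z => f x y z)) ->
  \sw_(x, y <- rho v) \sw_(x0, x1 <- rho x) f x0 x1 y =
  \sw_(x, y <- rho v) \Sw_(y1, y2 <- y) f x y1 y2.
Proof.
move=> f1 f2 f3.
have fB2 x : bilinear (f x) by split=> ?.
have fB3 : bilinear (fun (x : V) (z : H \ox H) => tsum z (f x)).
  split=> u; first by apply lin_tsum => ? ?; apply: f1.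
  by apply lin_tsum_arg; [lin|by apply: bil_balanced].
have := congr1 (fun t => tsum t (fun x z => tsum z (f x))) (rho_coassoc v).
rewrite !tsum_tsum; try exact: bil_balanced.
under eq_tsum => x y.
  rewrite tsum_tsum; last exact: bil_balanced.
  under eq_tsum => x0 x1.
    rewrite tsum_pure; last exact: bil_balanced.
    rewrite tsum_pure; last exact: bil_balanced.
    over.
  over.
move=> ->; apply: eq_tsum => x y.
by rewrite tsum_pure //; exact: bil_balanced.
Qed.

Lemma coassocE (H : coalgebra k) (W : lmodType k)
    (f : H -> H -> H -> W) h :
  (forall y z, linear (fun x => f x y z)) ->
  (forall x z, linear (fun y => f x y z)) ->
  (forall x y, linear (fun z => f x y z)) ->
  \Sw_(x, y <- h) \Sw_(x1, x2 <- x) f x1 x2 y =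
  \Sw_(x, y <- h) \Sw_(y1, y2 <- y) f x y1 y2.
Proof. exact: (@rho_coassocE H (regular_comodule H)). Qed.

Section Bialg.
Variable H : coquasi_bialgebra k.
Implicit Types (h g x y : H).
Local Notation "'1H'" := (hone H).
Local Notation "h ** g" := (hmul h g) (at level 40, left associativity).

Lemma sw2_one (W : lmodType k) (f : H -> H -> W) :
  bilinear f -> sw2 1H f = f 1H 1H.
Proof. by move=> fB; rewrite /sw2 Delta1 (tsum_pure (bil_balanced fB)). Qed.


Lemma counitlE (W : lmodType k) (f : H -> W) h : linear f ->
  \Sw_(h1, h2 <- h) counit h1 *: f h2 = f h.
Proof.
move=> fL; rewrite -[in RHS](counitl h) (tsum_comp_lin _ _ fL).
by apply: eq_tsum => x y; have [_ ->] := (linP f).1 fL.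
Qed.

Lemma counitrE (W : lmodType k) (f : H -> W) h : linear f ->
  \Sw_(h1, h2 <- h) counit h2 *: f h1 = f h.
Proof.
move=> fL; rewrite -[in RHS](counitr h) (tsum_comp_lin _ _ fL).
by apply: eq_tsum => x y; have [_ ->] := (linP f).1 fL.
Qed.

Lemma omega11l x : omega 1H 1H x = counit x.
Proof. by rewrite omega1 counit1 mul1r. Qed.

Lemma omega1l_idem x y : omega 1H x y =
  \Sw_(x1, x2 <- x) \Sw_(y1, y2 <- y) omega 1H x1 y1 * omega 1H x2 y2.
Proof.
have := omega_cocycle 1H 1H x y.
rewrite (@sw2_one k^o); last by split=> ?; lin.
rewrite (@sw2_one k^o); last by split=> ?; lin.
rewrite (@sw2_one k^o); last by split=> ?; lin.
rewrite [sw3 1H _]/sw3 (@sw2_one k^o); last by split=> ?; lin.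
rewrite (@sw2_one k^o); last by split=> ?; lin.
rewrite hmul1l => e.
transitivity (\Sw_(x1, x2 <- x) \Sw_(y1, y2 <- y)
   omega 1H 1H (x1 ** y1) * omega 1H x2 y2).
  rewrite -[LHS](@counitlE k^o (fun x => omega 1H x y)); last by lin.
  apply: eq_tsum => x1 x2.
  rewrite -[omega 1H x2 y](@counitlE k^o (fun y => omega 1H x2 y)); last by lin.
  rewrite (@tsum_comp_lin _ _ _ _ _ _ k^o k^o _ _ ( *:%R _)); last by lin.
  apply: eq_tsum => y1 y2.
  by rewrite omega11l counit_mul -mulrA.
rewrite e; apply: eq_tsum => x1 x'.
transitivity (\Sw_(x2, x3 <- x') counit x3 *:
   (\Sw_(y1, y2 <- y) omega 1H x1 y1 * omega 1H x2 y2 : k^o)).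
  apply: eq_tsum => x2 x3.
  rewrite (@tsum_comp_lin _ _ _ _ _ _ k^o k^o _ _ ( *:%R _)); last by lin.
  by apply: eq_tsum => y1 y2; rewrite hmul1l omega11l mulrC.
by apply: (@counitrE k^o); lin.
Qed.

Lemma omega1l x y : omega 1H x y = counit x * counit y.
Proof.
have e x' y' : \Sw_(x1, x2 <- x') \Sw_(y1, y2 <- y')
    omegaV 1H x1 y1 * omega 1H x2 y2 = counit x' * counit y'.
  have := omegaVK 1H x' y'.
  by rewrite (@sw2_one k^o) ?counit1 ?mul1r //; split=> ?; lin.
rewrite -e.
transitivity (\Sw_(x1, x' <- x) \Sw_(y1, y' <- y)
   \Sw_(x2, x3 <- x') \Sw_(y2, y3 <- y')
    omegaV 1H x1 y1 * (omega 1H x2 y2 * omega 1H x3 y3)); last first.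
  apply: eq_tsum => x1 x'; apply: eq_tsum => y1 y'.
  rewrite (omega1l_idem x' y').
  rewrite (@tsum_comp_lin _ _ _ _ _ _ k^o k^o _ _ ( *%R _)); last by lin.
  apply: eq_tsum => x2 x3.
  by rewrite (@tsum_comp_lin _ _ _ _ _ _ k^o k^o _ _ ( *%R _)) //; last by lin.
transitivity (\Sw_(x', x3 <- x) \Sw_(x1, x2 <- x')
  \Sw_(y', y3 <- y) \Sw_(y1, y2 <- y')
    omegaV 1H x1 y1 * (omega 1H x2 y2 * omega 1H x3 y3)).
  rewrite -[LHS](@counitlE k^o (fun x => omega 1H x y)); last by lin.
  apply: eq_tsum => x' x3.
  rewrite -[omega 1H x3 y](@counitlE k^o (fun y => omega 1H x3 y)); last by lin.
  rewrite (@tsum_comp_lin _ _ _ _ _ _ k^o k^o _ _ ( *:%R _)); last by lin.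
  rewrite /sw2 [RHS]tsum_exch.
  apply: eq_tsum => y' y3.
  rewrite [LHS]mulrA -e [LHS]mulrC.
  rewrite (@tsum_comp_lin _ _ _ _ _ _ k^o k^o _ _ ( *%R _)); last by lin.
  apply: eq_tsum => x1 x2.
  rewrite (@tsum_comp_lin _ _ _ _ _ _ k^o k^o _ _ ( *%R _)); last by lin.
  by apply: eq_tsum => y1 y2; rewrite mulrC mulrA.
refine (etrans (@coassocE H k^o
  (fun x1 x2 x3 => \Sw_(y', y3 <- y) \Sw_(y1, y2 <- y')
    omegaV 1H x1 y1 * (omega 1H x2 y2 * omega 1H x3 y3)) _ _ _ _) _); try by intros; lin.
apply: eq_tsum => x1 x'.
rewrite /sw2 [RHS]tsum_exch; apply: eq_tsum => x2 x3.
refine (etrans (@coassocE H k^o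
  (fun y1 y2 y3 => omegaV 1H x1 y1 * (omega 1H x2 y2 * omega 1H x3 y3)) _ _ _ _) _); try by intros; lin.
by [].
Qed.

End Bialg.
End CoquasiBialgTheory.

Section RelHopf.
Variables (k : fieldType) (H : coquasi_bialgebra k).

Record comodule_algebra := ComoduleAlgebra {
  ca_comod :> comodule H;
  amul : ca_comod -> ca_comod -> ca_comod;
  aone : ca_comod;
  amul_bilinear : bilinear amul;
  rho_amul : forall a b, rho (amul a b) =
    \sw_(a0, a1 <- rho a) \sw_(b0, b1 <- rho b) amul a0 b0 \ox hmul a1 b1;
  rho_aone : rho aone = aone \ox hone H;
  amul1l : forall a, amul aone a = a;
  amul1r : forall a, amul a aone = a;
  amulA : forall a b c, amul (amul a b) c =
    \sw_(a0, a1 <- rho a) \sw_(b0, b1 <- rho b) \sw_(c0, c1 <- rho c)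
      omega a1 b1 c1 *: amul a0 (amul b0 c0)
}.

Record rel_hopf_module (A : comodule_algebra) := RelHopfModule {
  rhm_comod :> comodule H;
  ract : rhm_comod -> A -> rhm_comod;
  ract_bilinear : bilinear ract;
  rho_ract : forall m a, rho (ract m a) =
    \sw_(m0, m1 <- rho m) \sw_(a0, a1 <- rho a) ract m0 a0 \ox hmul m1 a1;
  ract1 : forall m, ract m (aone A) = m;
  ractA : forall m a b, ract (ract m a) b =
    \sw_(m0, m1 <- rho m) \sw_(a0, a1 <- rho a) \sw_(b0, b1 <- rho b)
      omega m1 a1 b1 *: ract m0 (amul a0 b0)
}.

Definition regular_rhm (A : comodule_algebra) : rel_hopf_module A :=
  RelHopfModule (@amul_bilinear A) (@rho_amul A) (@amul1r A) (@amulA A).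

Section Coinvariants.
Variable V : comodule H.

Definition coinv_pred : {pred V} := fun v => rho v == v \ox hone H.

Fact coinv_zmod_closed : zmod_closed coinv_pred.
Proof.
have pB := bil_balanced (pure_bilinear V H).
split=> [|u v]; rewrite !unfold_in.
  by rewrite linear0 -[X in X \ox _](scale0r 0) (bilZl (pure_bilinear V H)) scale0r.
move=> /eqP eu /eqP ev; rewrite linearB /= eu ev.
rewrite (bilDl (pure_bilinear V H)) -[- v]scaleN1r.
by rewrite (bilZl (pure_bilinear V H)) scaleN1r.
Qed.
HB.instance Definition _ := GRing.isZmodClosed.Build V coinv_pred coinv_zmod_closed.

Record coinv := Coinv { coinv_val :> V; coinvP : coinv_val \in coinv_pred }.
HB.instance Definition _ := [isSub for coinv_val].
HB.instance Definition _ := [Choice of coinv by <:].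
HB.instance Definition _ := [SubChoice_isSubZmodule of coinv by <:].

Lemma rho_coinv (v : coinv) : rho (v : V) = (v : V) \ox hone H.
Proof. by case: v => v /= /eqP. Qed.

End Coinvariants.
End RelHopf.
Arguments coinv_pred {k H} V _.
#[global] Hint Resolve amul_bilinear ract_bilinear : bilin.

Section RelHopfTheory.
Variables (k : fieldType) (H : coquasi_bialgebra k).
Variable A : comodule_algebra H.

Lemma rho_counitE (V : comodule H) (W : lmodType k) (f : V -> W) v : linear f ->
  \sw_(x, y <- rho v) counit y *: f x = f v.
Proof.
move=> fL; rewrite -[in RHS](rho_counit v) (tsum_comp_lin _ _ fL).
by apply: eq_tsum => x y; have [_ ->] := (linP f).1 fL.
Qed.

Lemma tsum_coinv (V : comodule H) (W : lmodType k) (f : V -> H -> W) (v : coinv V) :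
  bilinear f -> tsum (rho (v : V)) f = f v (hone H).
Proof. by move=> fB; rewrite rho_coinv tsum_pure //; exact: bil_balanced. Qed.

Variable M : rel_hopf_module A.

Lemma ract_coinvA (m : M) (b : coinv A) (a : A) : ract (ract m b) a = ract m (amul b a).
Proof.
rewrite ractA -[RHS](rho_counitE (f := fun m => ract m (amul b a))); last by lin.
apply: eq_tsum => m0 m1.
rewrite tsum_coinv; last by split=> ?; lin.
rewrite -[ract m0 _](rho_counitE (f := fun a => ract m0 (amul b a))); last by lin.
rewrite (@tsum_comp_lin _ _ _ _ _ _ _ _ _ _ ( *:%R _)); last by lin.
by apply: eq_tsum => a0 a1; rewrite omega1 scalerA.
Qed.

Lemma coinv_ractA (m : coinv M) (a c : A) : ract (ract m a) c = ract m (amul a c).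
Proof.
rewrite ractA tsum_coinv; last by split=> ?; lin.
rewrite -[RHS](rho_counitE (f := fun a => ract m (amul a c))); last by lin.
apply: eq_tsum => a0 a1.
rewrite -[ract m _](rho_counitE (f := fun c => ract m (amul a0 c))); last by lin.
rewrite (@tsum_comp_lin _ _ _ _ _ _ _ _ _ _ ( *:%R _)); last by lin.
by apply: eq_tsum => c0 c1; rewrite omega1l scalerA.
Qed.

Lemma rho_ract_coinv (m : M) (b : coinv A) :
  rho (ract m b) = \sw_(m0, m1 <- rho m) ract m0 b \ox m1.
Proof.
rewrite rho_ract; apply: eq_tsum => m0 m1.
by rewrite tsum_coinv ?hmul1r //; split=> ?; lin.
Qed.

Lemma rho_coinv_ract (m : coinv M) (a : A) :
  rho (ract m a) = \sw_(a0, a1 <- rho a) ract m a0 \ox a1.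
Proof.
rewrite rho_ract tsum_coinv; last by split=> ?; lin.
by apply: eq_tsum => a0 a1; rewrite hmul1l.
Qed.

Lemma coinv_ract_subproof (m : coinv M) (b : coinv A) : ract m b \in coinv_pred M.
Proof.
rewrite unfold_in rho_ract_coinv tsum_coinv //; split=> ?; lin.
Qed.

End RelHopfTheory.

Section CoinvRing.
Variables (k : fieldType) (H : coquasi_bialgebra k) (A : comodule_algebra H).
Implicit Types a b c : coinv A.

Definition coinv_mul a b : coinv A :=
  Coinv (coinv_ract_subproof (M := regular_rhm A) a b).

Fact coinv_one_subproof : aone A \in coinv_pred A.
Proof. by rewrite unfold_in rho_aone. Qed.
Definition coinv_one : coinv A := Coinv coinv_one_subproof.

Fact coinv_mulA : associative coinv_mul.
Proof. by move=> a b c; apply: val_inj; rewrite /= -[LHS](ract_coinvA (M := regular_rhm A)). Qed.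
Fact coinv_mul1l : left_id coinv_one coinv_mul.
Proof. by move=> a; apply: val_inj; exact: amul1l. Qed.
Fact coinv_mul1r : right_id coinv_one coinv_mul.
Proof. by move=> a; apply: val_inj; exact: amul1r. Qed.
Fact coinv_mulDl : left_distributive coinv_mul +%R.
Proof. by move=> a b c; apply: val_inj; exact: (bilDl (amul_bilinear A)). Qed.
Fact coinv_mulDr : right_distributive coinv_mul +%R.
Proof. by move=> a b c; apply: val_inj; exact: (bilDr (amul_bilinear A)). Qed.

(* Not a nzRingType: coinv A is the zero ring when A = 0. *)
HB.instance Definition _ := GRing.Zmodule_isPzRing.Build (coinv A)
  coinv_mulA coinv_mul1l coinv_mul1r coinv_mulDl coinv_mulDr.

Section Module.
Variable M : rel_hopf_module A.

(* Right B-modules are left modules over the converse ring B^c. *)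
Definition coinv_scale (b : (coinv A)^c) (m : coinv M) : coinv M :=
  Coinv (coinv_ract_subproof m b).

Fact coinv_scaleA a b m :
  coinv_scale a (coinv_scale b m) = coinv_scale ((a : (coinv A)^c) * b) m.
Proof. by apply: val_inj; exact: ract_coinvA. Qed.
Fact coinv_scale1 : left_id (1 : (coinv A)^c) coinv_scale.
Proof. by move=> m; apply: val_inj; exact: ract1. Qed.
Fact coinv_scaleDr : right_distributive coinv_scale +%R.
Proof. by move=> b m m'; apply: val_inj; exact: (bilDl (ract_bilinear M)). Qed.
Fact coinv_scaleDl m : {morph coinv_scale^~ m : a b / a + b}.
Proof. by move=> a b; apply: val_inj; exact: (bilDr (ract_bilinear M)). Qed.

HB.instance Definition _ := GRing.Zmodule_isLmodule.Build (coinv A)^c (coinv M)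
  coinv_scaleA coinv_scale1 coinv_scaleDr coinv_scaleDl.
End Module.
End CoinvRing.


Section Induction.
Variables (k : fieldType) (H : coquasi_bialgebra k) (A : comodule_algebra H).

Definition lact (b : coinv A) (a : A) : A := amul b a.
Definition ractB (b : coinv A) (a : A) : A := amul a b.

Lemma amul_coinvA (a : A) (b : coinv A) (c : A) :
  amul (amul a b) c = amul a (amul b c).
Proof. exact: (ract_coinvA (M := regular_rhm A)). Qed.
Lemma coinv_amulA (b : coinv A) (a c : A) :
  amul (amul b a) c = amul b (amul a c).
Proof. exact: (coinv_ractA (M := regular_rhm A)). Qed.

Lemma rho_lact (b : coinv A) (a : A) :
  rho (lact b a) = \sw_(a0, a1 <- rho a) lact b a0 \ox a1.
Proof. exact: (rho_coinv_ract (M := regular_rhm A)). Qed.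

Lemma lact_amul (b : coinv A) (a c : A) : amul (lact b a) c = lact b (amul a c).
Proof. exact: coinv_amulA. Qed.

Section Object.
Variable N : lmodType (coinv A)^c.

Definition modB_act (b : coinv A) (n : N) : N := (b : (coinv A)^c) *: n.

(* N (x)_B A *)
Definition ind_sort := tens modB_act lact.

Definition ind_rho (t : ind_sort) : ind_sort \ox H :=
  \sw_(n, a <- t) \sw_(a0, a1 <- rho a) (pure n a0 : ind_sort) \ox a1.

Fact ind_rho_balanced : balanced modB_act lact
  (fun n a => \sw_(a0, a1 <- rho a) (pure n a0 : ind_sort) \ox a1).
Proof.
have aL n : linear (fun a : A => \sw_(a0, a1 <- rho a) (pure n a0 : ind_sort) \ox a1).
  by lin.
split=> [n n' a|n a a'|c n a|b n a].
- rewrite /tsum -big_split; apply: eq_bigr => p _.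
  by rewrite pureDl (bilDl (pure_bilinear _ _)).
- by have /linP[] := aL n.
- by have /linP[_] := aL n.
rewrite rho_lact tsum_tsum; last by bal.
apply: eq_tsum => a0 a1.
by rewrite tsum_pure; [rewrite pureB|bal].
Qed.

Lemma ind_rho_pure n a : ind_rho (pure n a) =
  \sw_(a0, a1 <- rho a) (pure n a0 : ind_sort) \ox a1.
Proof. exact: (tsum_pure ind_rho_balanced). Qed.

Fact ind_rho_linear : linear ind_rho.
Proof. exact: (tsum_is_linear ind_rho_balanced). Qed.
HB.instance Definition _ := GRing.isLinear.Build k _ _ _ ind_rho ind_rho_linear.

Fact ind_rho_coassoc (t : ind_sort) :
  \sw_(x, y <- ind_rho t) \sw_(x0, x1 <- ind_rho x) x0 \ox (x1 \ox y) =
  \sw_(x, y <- ind_rho t) x \ox Delta y.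
Proof.
apply: (tens_ext (F := fun t => \sw_(x, y <- ind_rho t)
                           \sw_(x0, x1 <- ind_rho x) x0 \ox (x1 \ox y))
                 (G := fun t => \sw_(x, y <- ind_rho t) x \ox Delta y)).
- by lin.
- by lin.
move=> n a; rewrite ind_rho_pure !tsum_tsum; try by bal.
have e := congr1 (fun t => \sw_(x, z <- t) (pure n x : ind_sort) \ox z) (rho_coassoc a).
rewrite !tsum_tsum in e; try by bal.
transitivity (\sw_(x, y <- rho a) \sw_(x0, x1 <- rho x)
   (pure n x0 : ind_sort) \ox (x1 \ox y)); last first.
  apply: etrans (etrans e _).
    apply: eq_tsum => x y; rewrite tsum_tsum; last by bal.
    by apply: eq_tsum => x0 x1; rewrite tsum_pure //; bal.
  by apply: eq_tsum => x y; rewrite !tsum_pure //; bal.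
apply: eq_tsum => x y; rewrite tsum_pure; last by bal.
rewrite ind_rho_pure tsum_tsum; last by bal.
by apply: eq_tsum => x0 x1; rewrite tsum_pure //; bal.
Qed.

Fact ind_rho_counit (t : ind_sort) : \sw_(x, y <- ind_rho t) counit y *: x = t.
Proof.
apply: (tens_ext (F := fun t => \sw_(x, y <- ind_rho t) counit y *: x)
                 (G := fun t => t)); [by lin|by lin|].
move=> n a; rewrite ind_rho_pure tsum_tsum; last by bal.
rewrite -[RHS](rho_counitE (f := fun a => (pure n a : ind_sort))); last by lin.
by apply: eq_tsum => x y; rewrite tsum_pure //; bal.
Qed.

Definition ind_comodule : comodule H := Comodule ind_rho_coassoc ind_rho_counit.

Definition ind_act (t : ind_comodule) (c : A) : ind_comodule :=
  \sw_(n, a <- (t : ind_sort)) (pure n (amul a c) : ind_sort).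

Fact ind_act_balanced (c : A) : balanced modB_act lact
  (fun n a => pure n (amul a c) : ind_sort).
Proof.
split=> [n n' a|n a a'|d n a|b n a].
- by rewrite pureDl.
- by rewrite (bilDl (amul_bilinear A)) pureDr.
- by rewrite (bilZl (amul_bilinear A)) pureZr.
by rewrite pureB lact_amul.
Qed.

Lemma ind_act_pure n a c :
  ind_act (pure n a : ind_sort) c = (pure n (amul a c) : ind_sort).
Proof. exact: (tsum_pure (ind_act_balanced c)). Qed.

Fact ind_act_bilinear : bilinear ind_act.
Proof.
split=> [c|t]; first exact: (tsum_is_linear (ind_act_balanced c)).
by rewrite /ind_act; lin.
Qed.
Hint Resolve ind_act_bilinear : bilin.

Fact rho_ind_act (t : ind_comodule) (c : A) : rho (ind_act t c) =
  \sw_(t0, t1 <- rho t) \sw_(c0, c1 <- rho c) ind_act t0 c0 \ox hmul t1 c1.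
Proof.
apply: (tens_ext (F := fun t => rho (ind_act t c : ind_comodule))
  (G := fun t => \sw_(t0, t1 <- rho (t : ind_comodule)) \sw_(c0, c1 <- rho c)
     ind_act t0 c0 \ox hmul t1 c1)); [by lin|by lin|].
move=> n a; rewrite /= ind_act_pure !ind_rho_pure rho_amul.
rewrite !tsum_tsum; try by bal.
apply: eq_tsum => a0 a1; rewrite tsum_tsum; last by bal.
rewrite tsum_pure; last by bal.
by apply: eq_tsum => c0 c1; rewrite ind_act_pure tsum_pure //; bal.
Qed.

Fact ind_act1 (t : ind_comodule) : ind_act t (aone A) = t.
Proof.
apply: (tens_ext (F := fun t => ind_act t (aone A)) (G := fun t => t));
  [by lin|by lin|].
by move=> n a; rewrite ind_act_pure amul1r.
Qed.

Fact ind_actA (t : ind_comodule) (a b : A) : ind_act (ind_act t a) b =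
  \sw_(t0, t1 <- rho t) \sw_(a0, a1 <- rho a) \sw_(b0, b1 <- rho b)
    omega t1 a1 b1 *: ind_act t0 (amul a0 b0).
Proof.
apply: (tens_ext (F := fun t => ind_act (ind_act t a) b)
  (G := fun t => \sw_(t0, t1 <- rho (t : ind_comodule))
     \sw_(a0, a1 <- rho a) \sw_(b0, b1 <- rho b)
    omega t1 a1 b1 *: ind_act t0 (amul a0 b0))); [by lin|by lin|].
move=> n c; rewrite !ind_act_pure /= ind_rho_pure amulA.
have pL : linear (fun a : A => (pure n a : ind_sort)) by lin.
rewrite (tsum_comp_lin _ _ pL) tsum_tsum; last by bal.
apply: eq_tsum => c0 c1; rewrite (tsum_comp_lin _ _ pL) tsum_pure; last by bal.
apply: eq_tsum => a0 a1; rewrite (tsum_comp_lin _ _ pL).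
by apply: eq_tsum => b0 b1; rewrite ind_act_pure pureZr.
Qed.

Definition ind_rhm : rel_hopf_module A :=
  RelHopfModule ind_act_bilinear rho_ind_act ind_act1 ind_actA.

End Object.
End Induction.
Section Canonical.
Variables (k : fieldType) (H : coquasi_hopf k) (A : comodule_algebra H).

(* A (x)_B A *)
Definition tensBA := tens (@ractB k H A) (@lact k H A).

Definition can (t : tensBA) : A \ox H :=
  \sw_(a, b <- t) \sw_(a0, a1 <- rho a) \sw_(b0, b' <- rho b)
    \Sw_(b1, b2, b3, b4 <- b')
      omegaV a1 (beta b2 *: b1) (antipode b3) *: (amul a0 b0 \ox b4).

Fact can_balanced : balanced (@ractB k H A) (@lact k H A)
  (fun a b => \sw_(a0, a1 <- rho a) \sw_(b0, b' <- rho b)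
    \Sw_(b1, b2, b3, b4 <- b')
      omegaV a1 (beta b2 *: b1) (antipode b3) *: (amul a0 b0 \ox b4)).
Proof.
set F := (fun a b => _).
have FB : bilinear F by split=> ?; lin.
split=> [a a' b|a b b'|c a b|b' a b].
- exact: bilDl.
- exact: bilDr.
- exact: bilZr.
rewrite /F (@rho_ract_coinv _ _ _ (regular_rhm A)) tsum_tsum; last first.
  by apply: bil_balanced; split=> ?; lin.
apply: eq_tsum => a0 a1.
rewrite tsum_pure; last by apply: bil_balanced; split=> ?; lin.
rewrite (@rho_coinv_ract _ _ _ (regular_rhm A)) tsum_tsum; last first.
  by apply: bil_balanced; split=> ?; lin.
apply: eq_tsum => b0 b1.
rewrite tsum_pure; last by apply: bil_balanced; split=> ?; lin.
by rewrite /= amul_coinvA.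
Qed.

Lemma can_pure a b : can (pure a b) =
  \sw_(a0, a1 <- rho a) \sw_(b0, b' <- rho b) \Sw_(b1, b2, b3, b4 <- b')
    omegaV a1 (beta b2 *: b1) (antipode b3) *: (amul a0 b0 \ox b4).
Proof. exact: (tsum_pure can_balanced). Qed.

End Canonical.


#[local] Obligation Tactic := idtac.

Section Categories.

Record category := Category {
  obj :> Type;
  hom : obj -> obj -> Type;
  idm : forall x, hom x x;
  cmp : forall x y z, hom y z -> hom x y -> hom x z;
  cmp_idl : forall x y (f : hom x y), cmp (idm y) f = f;
  cmp_idr : forall x y (f : hom x y), cmp f (idm x) = f;
  cmpA : forall x y z w (f : hom z w) (g : hom y z) (h : hom x y),
    cmp f (cmp g h) = cmp (cmp f g) h
}.
Arguments idm {_}.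

Record functor (C D : category) := Functor {
  fobj :> C -> D;
  fmap : forall x y, hom x y -> hom (fobj x) (fobj y);
  fmap_id : forall x, fmap (idm x) = idm (fobj x);
  fmap_cmp : forall x y z (f : hom y z) (g : hom x y),
    fmap (cmp f g) = cmp (fmap f) (fmap g)
}.

Definition id_functor (C : category) : functor C C :=
  @Functor C C id (fun x y f => f) (fun x => erefl) (fun x y z f g => erefl).

Program Definition comp_functor (C D E : category)
    (G : functor D E) (F : functor C D) : functor C E :=
  @Functor C E (fun x => G (F x)) (fun x y f => fmap G (fmap F f)) _ _.
Next Obligation. by move=> C D E G F x /=; rewrite !fmap_id. Qed.
Next Obligation. by move=> C D E G F x y z f g /=; rewrite !fmap_cmp. Qed.

Record nat_trans (C D : category) (F G : functor C D) := NatTrans {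
  nt :> forall x, hom (F x) (G x);
  nt_natural : forall x y (f : hom x y), cmp (nt y) (fmap F f) = cmp (fmap G f) (nt x)
}.

Definition iso (C : category) (x y : C) (f : hom x y) :=
  exists g : hom y x, cmp g f = idm x /\ cmp f g = idm y.

Record adjunction (C D : category) (F : functor C D) (G : functor D C) :=
  Adjunction {
  adj_unit : nat_trans (id_functor C) (comp_functor G F);
  adj_counit : nat_trans (comp_functor F G) (id_functor D);
  adj_triangleL : forall x, cmp (adj_counit (F x)) (fmap F (adj_unit x)) = idm (F x);
  adj_triangleR : forall y, cmp (fmap G (adj_counit y)) (adj_unit (G y)) = idm (G y)
}.

(* The pair of adjoint functors (F, G) is a pair of inverse equivalences via its
   unit Id -> G F and counit F G -> Id; naturality is part of nat_trans. *)
Definition inverse_equivalences (C D : category) (F : functor C D)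
    (G : functor D C) (adj : adjunction F G) :=
  (forall x, iso (adj_unit adj x)) /\ (forall y, iso (adj_counit adj y)).

End Categories.
Arguments idm {_}.

Lemma linear_ext (R : pzRingType) (U V : lmodType R) (f g : {linear U -> V}) :
  f =1 g -> f = g.
Proof.
case: f g => f [[f1] [f2]] [g [[g1] [g2]]] /= /funext fg.
by subst g; congr GRing.Linear.Pack; congr GRing.Linear.Class;
   [congr Algebra.isNmodMorphism.Axioms_|congr GRing.isScalable.Axioms_];
   apply: Prop_irrelevance.
Qed.

Program Definition rmod (R : pzRingType) : category :=
  @Category (lmodType R^c) (fun M N => {linear M -> N})
    (fun M => (idfun : {linear M -> M}))
    (fun M N P f g => (f \o g : {linear M -> P}))
    _ _ _.
Next Obligation. by move=> *; apply: linear_ext. Qed.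
Next Obligation. by move=> *; apply: linear_ext. Qed.
Next Obligation. by move=> *; apply: linear_ext. Qed.

Section RhmCategory.
Variables (k : fieldType) (H : coquasi_bialgebra k) (A : comodule_algebra H).

Record rhm_hom (M M' : rel_hopf_module A) := RhmHom {
  rhm_lin :> {linear M -> M'};
  rhm_colinear : colinear rhm_lin;
  rhm_ract : forall m a, rhm_lin (ract m a) = ract (rhm_lin m) a
}.

Lemma rhm_hom_ext (M M' : rel_hopf_module A) (f g : rhm_hom M M') :
  f =1 g -> f = g.
Proof.
case: f g => f f1 f2 [g g1 g2] /= /linear_ext fg; subst g.
by congr RhmHom; apply: Prop_irrelevance.
Qed.

Program Definition rhm_id (M : rel_hopf_module A) : rhm_hom M M :=
  @RhmHom M M (idfun : {linear M -> M}) _ _.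
Next Obligation. by move=> M m; rewrite /= tsum_pureE. Qed.
Next Obligation. by []. Qed.

Program Definition rhm_comp (M N P : rel_hopf_module A)
    (f : rhm_hom N P) (g : rhm_hom M N) : rhm_hom M P :=
  @RhmHom M P (f \o g : {linear M -> P}) _ _.
Next Obligation.
move=> M N P f g m; rewrite /= rhm_colinear rhm_colinear.
rewrite tsum_tsum; last by bal.
by apply: eq_tsum => m0 m1; rewrite tsum_pure //; bal.
Qed.
Next Obligation. by move=> M N P f g m a; rewrite /= !rhm_ract. Qed.

Program Definition rhm_category : category :=
  @Category (rel_hopf_module A) rhm_hom rhm_id rhm_comp
 _ _ _.
Next Obligation. by move=> *; apply: rhm_hom_ext. Qed.
Next Obligation. by move=> *; apply: rhm_hom_ext. Qed.
Next Obligation. by move=> *; apply: rhm_hom_ext. Qed.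

Section CoinvMap.
Variables (M M' : rel_hopf_module A) (f : rhm_hom M M').

Fact coinv_map_subproof (m : coinv M) : f (coinv_val m) \in coinv_pred M'.
Proof.
rewrite unfold_in rhm_colinear tsum_coinv //; split=> ?; lin.
Qed.
Definition coinv_map (m : coinv M) : coinv M' := Coinv (coinv_map_subproof m).
Fact coinv_map_linear : linear coinv_map.
Proof.
move=> b m m'; apply: val_inj.
by rewrite /= linearD /= rhm_ract.
Qed.
HB.instance Definition _ := GRing.isLinear.Build (coinv A)^c (coinv M) (coinv M')
  _ coinv_map coinv_map_linear.
End CoinvMap.

Program Definition coinv_functor : functor rhm_category (rmod (coinv A)) :=
  @Functor rhm_category (rmod (coinv A)) (fun M => (coinv M : lmodType _))
    (fun M M' f => (coinv_map f : {linear _ -> _})) _ _.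
Next Obligation. by move=> M; apply: linear_ext => m; apply: val_inj. Qed.
Next Obligation. by move=> M N P f g; apply: linear_ext => m; apply: val_inj. Qed.

Section IndMap.
Variables (N N' : lmodType (coinv A)^c) (f : {linear N -> N'}).

Definition ind_map (t : ind_rhm N) : ind_rhm N' :=
  \sw_(n, a <- (t : ind_sort N)) (pure (f n) a : ind_sort N').

Fact ind_map_balanced : balanced (@modB_act _ _ _ N) (@lact _ _ A)
  (fun n a => pure (f n) a : ind_sort N').
Proof.
split=> [n n' a|n a a'|d n a|b n a].
- by rewrite linearD pureDl.
- by rewrite pureDr.
- by rewrite pureZr.
by rewrite /modB_act linearZ /= -/(modB_act b (f n)) pureB.
Qed.

Lemma ind_map_pure n a :
  ind_map (pure n a : ind_sort N) = (pure (f n) a : ind_sort N').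
Proof. exact: (tsum_pure ind_map_balanced). Qed.

Fact ind_map_linear : linear ind_map.
Proof. exact: (tsum_is_linear ind_map_balanced). Qed.
HB.instance Definition _ := GRing.isLinear.Build k (ind_rhm N) (ind_rhm N') _
  ind_map ind_map_linear.

Fact ind_map_colinear : colinear ind_map.
Proof.
move=> t.
apply: (tens_ext (F := fun t => rho (ind_map t))
  (G := fun t => \sw_(x, y <- rho (t : ind_rhm N)) ind_map x \ox y));
  [by lin|by lin|].
move=> n a; rewrite ind_map_pure /= !ind_rho_pure tsum_tsum; last by bal.
by apply: eq_tsum => a0 a1; rewrite tsum_pure ?ind_map_pure //; bal.
Qed.

Fact ind_map_ract (t : ind_rhm N) (c : A) :
  ind_map (ract t c) = ract (ind_map t) c.
Proof.
apply: (tens_ext (F := fun t => ind_map (ract (t : ind_rhm N) c))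
  (G := fun t => ract (ind_map t) c)); [by lin|by lin|].
by move=> n a; rewrite /= ind_act_pure !ind_map_pure ind_act_pure.
Qed.

Definition ind_hom : rhm_hom (ind_rhm N) (ind_rhm N') :=
  @RhmHom _ _ ind_map ind_map_colinear ind_map_ract.

End IndMap.

Lemma ind_linear_ext (N : lmodType (coinv A)^c) (W : lmodType k)
  (F G : {linear ind_rhm N -> W}) :
  (forall n a, F (pure n a : ind_sort N) = G (pure n a : ind_sort N)) -> F =1 G.
Proof. by move=> FG; apply: (tens_ext (F := F) (G := G)) => //; apply: linearP. Qed.

Program Definition ind_functor : functor (rmod (coinv A)) rhm_category :=
  @Functor (rmod (coinv A)) rhm_category (@ind_rhm _ _ A) ind_hom _ _.
Next Obligation.
move=> N; apply: rhm_hom_ext; apply: ind_linear_ext => n a.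
exact: ind_map_pure.
Qed.
Next Obligation.
move=> N N' N'' f g; apply: rhm_hom_ext; apply: ind_linear_ext => n a /=.
by rewrite !ind_map_pure.
Qed.

Section Unit.
Variable N : lmodType (coinv A)^c.
Fact ind_unit_subproof (n : N) :
  (pure n (aone A) : ind_sort N) \in coinv_pred (ind_rhm N).
Proof.
rewrite unfold_in /= ind_rho_pure rho_aone tsum_pure //; bal.
Qed.
Definition ind_unit (n : N) : coinv (ind_rhm N) := Coinv (ind_unit_subproof n).
Fact ind_unit_linear : linear ind_unit.
Proof.
move=> b n n'; apply: val_inj; rewrite /= pureDl ind_act_pure.
by rewrite -/(modB_act b n) pureB /lact amul1r amul1l.
Qed.
HB.instance Definition _ := GRing.isLinear.Build (coinv A)^c N (coinv (ind_rhm N))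
  _ ind_unit ind_unit_linear.
End Unit.

Section Counit.
Variable M : rel_hopf_module A.
Definition ind_counit (t : ind_rhm (coinv M)) : M :=
  \sw_(m, a <- (t : ind_sort (coinv M))) ract (m : M) a.

Fact ind_counit_balanced : balanced (@modB_act _ _ _ (coinv M)) (@lact _ _ A)
  (fun m a => ract (m : M) a).
Proof.
split=> [n n' a|n a a'|d n a|b n a].
- exact: (bilDl (ract_bilinear M)).
- exact: (bilDr (ract_bilinear M)).
- exact: (bilZr (ract_bilinear M)).
exact: ract_coinvA.
Qed.

Lemma ind_counit_pure (m : coinv M) (a : A) :
  ind_counit (pure m a : ind_sort (coinv M)) = ract (m : M) a.
Proof. exact: (tsum_pure ind_counit_balanced). Qed.

Fact ind_counit_linear : linear ind_counit.
Proof. exact: (tsum_is_linear ind_counit_balanced). Qed.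
HB.instance Definition _ := GRing.isLinear.Build k (ind_rhm (coinv M)) M _
  ind_counit ind_counit_linear.

Fact ind_counit_colinear : colinear ind_counit.
Proof.
move=> t.
apply: (tens_ext (F := fun t => rho (ind_counit t))
  (G := fun t => \sw_(x, y <- rho (t : ind_rhm (coinv M))) ind_counit x \ox y));
  [by lin|by lin|].
move=> n a; rewrite ind_counit_pure /= !ind_rho_pure tsum_tsum; last by bal.
rewrite rho_coinv_ract.
by apply: eq_tsum => a0 a1; rewrite tsum_pure ?ind_counit_pure //; bal.
Qed.

Fact ind_counit_ract (t : ind_rhm (coinv M)) (c : A) :
  ind_counit (ract t c) = ract (ind_counit t) c.
Proof.
apply: (tens_ext (F := fun t => ind_counit (ract (t : ind_rhm (coinv M)) c))
  (G := fun t => ract (ind_counit t) c)); [by lin|by lin|].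
by move=> n a; rewrite /= ind_act_pure !ind_counit_pure coinv_ractA.
Qed.

Definition ind_counit_hom : rhm_hom (ind_rhm (coinv M)) M :=
  @RhmHom _ _ ind_counit ind_counit_colinear ind_counit_ract.
End Counit.

Program Definition ind_unit_nt :
    nat_trans (id_functor _) (comp_functor coinv_functor ind_functor) :=
  @NatTrans (rmod (coinv A)) (rmod (coinv A)) _ _
    (fun N => (@ind_unit N : {linear _ -> _})) _.
Next Obligation.
move=> N N' f; apply: linear_ext => n; apply: val_inj => /=.
by rewrite ind_map_pure.
Qed.

Program Definition ind_counit_nt :
    nat_trans (comp_functor ind_functor coinv_functor) (id_functor _) :=
  @NatTrans rhm_category rhm_category _ _ ind_counit_hom _.
Next Obligation.
move=> M M' f; apply: rhm_hom_ext; apply: ind_linear_ext => m a /=.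
by rewrite ind_map_pure !ind_counit_pure /= rhm_ract.
Qed.

Program Definition ind_coinv_adjunction : adjunction ind_functor coinv_functor :=
  @Adjunction _ _ _ _ ind_unit_nt ind_counit_nt _ _.
Next Obligation.
move=> N; apply: rhm_hom_ext; apply: ind_linear_ext => n a /=.
by rewrite ind_map_pure ind_counit_pure /= ind_act_pure amul1l.
Qed.
Next Obligation.
move=> M; apply: linear_ext => m; apply: val_inj => /=.
by rewrite ind_counit_pure ract1.
Qed.

Definition total_integral (gamma : {linear H -> A}) :=
  colinear (V := regular_comodule H) gamma /\ gamma (hone H) = aone A.

End RhmCategory.

(* Main.v *)
(* Write S for the antipode and g for the total integral.  For every relative Hopf
   module M the map m |-> m_0 beta(m_1) g(S(m_2)) is a natural projection onto the
   coinvariants.  For M = A it is left B-linear and retracts n |-> n (x) 1, and for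
   M = N (x)_B A it shows that every coinvariant has the form n (x) 1; hence the
   unit is bijective.

   For the counit, m in M gives a colinear map chi_m : H -> M, a twisted version of
   h |-> m_0 g(S(m_1) h), with m = alpha(m_1) chi_{m_0}(m_2).  Bijectivity of S
   yields coinvariants theta_m(l) = beta(S^-1(l_1)) chi_m(S^-1(l_2)) l_0 for l in
   A, and there is a linear map Phi_m on A (x) H with
   Phi_m(can(l (x) r)) = theta_m(l) r and Phi_m(1 (x) h) = chi_m(h).  Writing
   1 (x) h = can(sum l_i (x) r_i) gives chi_m(h) = sum theta_m(l_i) r_i, so the
   counit is surjective.  All of this is natural in M: if x is in the kernel of the
   counit, so is m for every m occurring in rho(x); then theta_m(l) is a coinvariant
   n (x) 1 with n = 0, whence x = 0. *)

From HB Require Import structures.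
From mathcomp Require Import all_boot all_algebra.
From mathcomp Require Import boolp classical_sets.
From mathcomp Require Import ring.
Require Import Defs.

Set Implicit Arguments.
Unset Strict Implicit.
Unset Printing Implicit Defensive.
Import GRing.Theory.
Local Open Scope ring_scope.

(** * Linear functionals *)

Section Functionals.
Variables (k : fieldType) (V : lmodType k).

(** By Zorn's lemma there is a maximal subspace [X] avoiding [v]. Maximality makes [X] a complement
    of the line through [v], and [f] is the coordinate along [v]. *)
Lemma separating_functional (v : V) : v != 0 -> exists f : {scalar V}, f v = 1.
Proof.
move=> v0.
pose P (X : set V) := (forall c x y, X x -> X y -> X (c *: x + y)) /\ ~ X v.
have [F FP totF|X [[XL Xv] Xmax]] := @Zorn_bigcup V P.
  split=> [c x y [Y FY Yx] [Z FZ Zy]|[Y /FP[_ +] //]].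
  have [YZ|ZY] := totF _ _ FY FZ.
    by exists Z => //; apply: (FP _ FZ).1 => //; apply: YZ.
  by exists Y => //; apply: (FP _ FY).1 => //; apply: ZY.
(* [P] does not ask for 0, so that the union of an empty chain satisfies it. A maximal [X] without 0
   would be empty, hence strictly contained in the zero subspace. *)
have X0 : X 0.
  apply: contrapT => X0; apply: (Xmax (fun x => x = 0)); last first.
    split=> [c x y -> ->|/= /eqP]; first by rewrite scaler0 addr0.
    by rewrite (negPf v0).
  split=> [x Xx|/(_ 0 erefl)//].
  by case: X0; have := XL (-1) _ _ Xx Xx; rewrite scaleN1r addNr.
have XZ c x : X x -> X (c *: x) by move=> Xx; rewrite -[_ *: _]addr0; apply: XL.
have decomp w : exists c, X (w - c *: v).
  apply: contrapT => nX.
  (* Otherwise the span of [X] and [w] would be strictly larger and still avoid [v]. *)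
  apply: (Xmax (fun y => exists c x, X x /\ y = c *: w + x)); split.
  - by move=> x Xx; exists 0, x; rewrite scale0r add0r.
  - move=> XX; apply: nX; exists 0; rewrite scale0r subr0; apply: XX.
    by exists 1, 0; rewrite scale1r addr0.
  - move=> c _ _ [a [x [Xx ->]]] [b [y [Xy ->]]].
    exists (c * a + b), (c *: x + y); split; first exact: XL.
    by rewrite scalerDr scalerDl !scalerA addrACA.
  - case=> c [x [Xx ev]]; have [c0|c0] := eqVneq c 0.
      by apply: Xv; rewrite ev c0 scale0r add0r.
    apply: nX; exists c^-1; rewrite [X in _ *: X]ev scalerDr scalerA mulVf // scale1r.
    by rewrite opprD addNKr -scaleNr; apply: XZ.
have uniq w c d : X (w - c *: v) -> X (w - d *: v) -> c = d.
  move=> Xc Xd; apply/eqP; rewrite -subr_eq0; apply/negPn/negP => cd; apply: Xv.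
  have := XZ (d - c)^-1 _ (XL (-1) _ _ Xd Xc).
  rewrite scaleN1r opprB addrA subrK -scalerBl scalerA mulVf ?scale1r //.
  by rewrite -oppr_eq0 opprB.
pose f w := sval (cid (decomp w)).
have fP w : X (w - f w *: v) by exact: svalP (cid (decomp w)).
have fL : linear (f : V -> k^o).
  move=> c x y; apply: (uniq (c *: x + y)); first exact: fP.
  have := XL c _ _ (fP x) (fP y); congr X.
  by rewrite scalerBr scalerDl -scalerA opprD addrACA.
pose fM := GRing.isLinear.Build k V k *%R f fL.
exists (HB.pack_for {scalar V} f fM); apply/esym/(uniq v); last exact: fP.
by rewrite scale1r subrr.
Qed.

Definition submod_pred (P : V -> Prop) :=
  P 0 /\ forall c x y, P x -> P y -> P (c *: x + y).

(** A basis of the span of [s] with dual functionals defined on all of [V]; that [b i] lies in the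
    span is expressed by the clause on [P]. Induction on [s]: what remains of a new vector after
    subtracting its coordinates along [b] is either zero or becomes a new basis vector. *)
Lemma dual_family (s : seq V) : exists (n : nat) (b : 'I_n -> V)
    (f : 'I_n -> {scalar V}),
  [/\ forall i j, f i (b j) = (i == j)%:R,
      forall P, submod_pred P -> {in s, forall x, P x} -> forall i, P (b i) &
      {in s, forall x, x = \sum_i f i x *: b i}].
Proof.
elim: s => [|x s [n [b [f [fb bP bs]]]]].
  have F (T : Type) (i : 'I_0) : T by case: i.
  by exists 0%N, (F _), (F _); split=> [i|P _ _ i|//]; apply: F i.
pose pr y := y - \sum_i f i y *: b i.
have prL : linear pr.
  move=> c y z; rewrite /pr scalerBr addrACA -opprD; congr (_ - _).
  rewrite scaler_sumr -big_split; apply: eq_bigr => i _.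
  by rewrite linearP scalerDl scalerA.
have fpr i y : f i (pr y) = 0.
  rewrite linearB linear_sum /= (bigD1 i) //= linearZ /= fb eqxx mulr1.
  rewrite big1 ?addr0 ?subrr // => j /negPf ji.
  by rewrite linearZ /= fb eq_sym ji mulr0.
have sub P : submod_pred P -> P x -> (forall i, P (b i)) -> P (pr x).
  move=> [P0 PL] Px Pb; rewrite /pr addrC -scaleN1r; apply: (PL) => //.
  apply: (big_ind P) => // [y z Py Pz|i _].
    by rewrite -[y]scale1r; apply: PL.
  by rewrite -[X in P X]addr0; apply: PL.
have [px|px] := eqVneq (pr x) 0.
  exists n, b, f; split=> // [P PL Ps|y].
    by apply: bP => // y ys; apply: Ps; rewrite inE ys orbT.
  rewrite inE => /orP[/eqP ->|]; last exact: bs.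
  by apply/eqP; rewrite -subr_eq0 -/(pr x) px.
have [phi phix] := separating_functional px.
(* Composition with [pr], which kills every [b i], makes the new functional vanish on the old
   basis. *)
have psiL : scalar (fun y => phi (pr y)) by move=> c y z; rewrite prL linearP.
pose psi := HB.pack_for {scalar V} (fun y => phi (pr y))
  (GRing.isLinear.Build k V k *%R _ psiL).
pose b' i := oapp b (pr x) (unlift ord0 i).
pose f' i := oapp f psi (unlift (ord0 : 'I_n.+1) i).
have prb i : pr (b i) = 0.
  rewrite /pr (bigD1 i) //= fb eqxx scale1r big1 ?addr0 ?subrr //.
  by move=> j /negPf ji; rewrite fb ji scale0r.
have prK : pr (pr x) = pr x.
  by rewrite {1}/pr big1 ?subr0 // => i _; rewrite fpr scale0r.
exists n.+1, b', f'; split=> [i j|P PL Ps i|y].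
- rewrite /b' /f'; case: (unliftP ord0 i) => [i' ->|->];
    case: (unliftP ord0 j) => [j' ->|->] /=.
  + by rewrite fb (inj_eq (@lift_inj _ ord0)).
  + by rewrite fpr.
  + by rewrite prb linear0.
  + by rewrite prK phix.
- have Pb : forall i, P (b i).
    by apply: bP => // y ys; apply: Ps; rewrite inE ys orbT.
  rewrite /b'; case: (unliftP ord0 i) => [i' _|_] /=; first exact: Pb.
  by apply: sub => //; apply: Ps; rewrite inE eqxx.
- have decomp z : z = pr z + \sum_i f i z *: b i by rewrite subrK.
  rewrite inE big_ord_recl /b' /f' unlift_none /= => ys.
  under eq_bigr => i _ do rewrite liftK /=.
  have [->|yx] := eqVneq y x; first by rewrite {1}[x]decomp phix scale1r.
  move: ys; rewrite (negPf yx) /= => /bs es.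
  rewrite {1}[y]decomp; congr (_ + _).
  have -> : pr y = 0 by rewrite /pr -es subrr.
  by rewrite linear0 scale0r.
Qed.
End Functionals.

(** * Coordinates in comodules *)

Section Sums.
Variables (k : fieldType) (U W : lmodType k) (J : finType).

Lemma lin_0 (f : U -> W) : linear f -> f 0 = 0.
Proof. by move=> /linP[fD _]; apply: (addrI (f 0)); rewrite -fD !addr0. Qed.

Lemma lin_sum (f : U -> W) (F : J -> U) : linear f ->
  f (\sum_j F j) = \sum_j f (F j).
Proof. by move=> fL; rewrite (big_morph f ((linP f).1 fL).1 (lin_0 fL)). Qed.

Lemma lin_Z (f : U -> W) c u : linear f -> f (c *: u) = c *: f u.
Proof. by move=> /linP[_ ->]. Qed.

End Sums.

Section BilinearSums.
Variables (k : fieldType) (U V W : lmodType k) (J : finType).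

Lemma bil_suml (f : U -> V -> W) (F : J -> U) v : bilinear f ->
  f (\sum_j F j) v = \sum_j f (F j) v.
Proof. by move=> [fB _]; exact: (lin_sum F (fB v)). Qed.

Lemma bil_sumr (f : U -> V -> W) (F : J -> V) u : bilinear f ->
  f u (\sum_j F j) = \sum_j f u (F j).
Proof. by move=> [_ fB]; exact: (lin_sum F (fB u)). Qed.

End BilinearSums.

Section PureSums.
Variables (k : fieldType) (U V : lmodType k) (J : finType).

Lemma pureZl c (u : U) (v : V) : (c *: u) \ox v = c *: (u \ox v).
Proof. exact: (bilZl (pure_bilinear U V)). Qed.

Lemma pure_suml (F : J -> U) (v : V) : (\sum_j F j) \ox v = \sum_j F j \ox v.
Proof. exact: (bil_suml _ _ (pure_bilinear U V)). Qed.

Lemma pure_sumr (F : J -> V) (u : U) : u \ox (\sum_j F j) = \sum_j u \ox F j.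
Proof. exact: (bil_sumr _ _ (pure_bilinear U V)). Qed.
End PureSums.

Lemma tsum_sum_pure (k : fieldType) (M : zmodType) (N W : lmodType k) (I : Type)
    (r : I -> M -> M) (l : I -> N -> N) (J : finType) (m : J -> M) (n : J -> N)
    (f : M -> N -> W) : balanced r l f ->
  tsum (\sum_j (pure (m j) (n j) : tens r l)) f = \sum_j f (m j) (n j).
Proof.
by move=> fB; rewrite (tsum_sum fB); apply: eq_bigr => j _; exact: tsum_pure.
Qed.

Section Coordinates.
Variables (k : fieldType) (H : coalgebra k).

(* The matrix coefficients of a finite-dimensional comodule.  Iterated coproducts
   of c i j are sums over paths from i to j, so that coassociativity becomes
   invisible and Sweedler computations become manipulations of nested sums. *)
Definition comatrix (I : finType) (c : I -> I -> H) :=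
  (forall i j, Delta (c i j) = \sum_l c i l \ox c l j) /\
  (forall i j, counit (c i j) = (i == j)%:R).

Definition coordinates (V : comodule H) (I : finType) (b : I -> V)
    (c : I -> I -> H) :=
  comatrix c /\ forall i, rho (b i) = \sum_j b j \ox c j i.

(* Besides a basis of the subcomodule generated by v, we record that its vectors
   are images of v under functionals of H: a colinear map that kills v therefore
   kills the whole basis. *)
Lemma coordinates_exist (V : comodule H) (v : V) :
  exists (n : nat) (b : 'I_n -> V) (c : 'I_n -> 'I_n -> H) (x : 'I_n -> k),
  [/\ coordinates b c, v = \sum_i x i *: b i &
      forall i, exists g : {scalar H}, b i = \sw_(y, z <- rho v) g z *: y].
Proof.
(* [h] is a basis of the span of the right tensor factors of [rho v], and the [e i] are the
   corresponding left coefficients. *)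
have [n [h [g [_ _ hs]]]] := dual_family [seq p.2 | p <- trep (rho v)].
pose e i := \sw_(y, z <- rho v) g i z *: y.
have ev : rho v = \sum_i e i \ox h i.
  
  rewrite -{1}(tsum_pureE (rho v)) /e.
  under [RHS]eq_bigr => i _.
    rewrite (@tsum_comp_lin _ _ _ _ _ _ _ _ _ _ (fun u : V => u \ox h i));
      last by lin.
    over.
  rewrite /tsum exchange_big /=; apply: eq_big_seq => -[y z] yz /=.
  rewrite {1}[z]hs; last by apply/mapP; exists (y, z).
  by rewrite pure_sumr; apply: eq_bigr => i _; rewrite pureZl pureZr.
(* By coassociativity [rho (e i)] arises from [rho v] by applying [Delta], then [g i], to the right
   factor; so the [e j] span a subcomodule. *)
have re i : exists d, rho (e i) = \sum_j e j \ox d j.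
  exists (fun j => \Sw_(y1, y2 <- h j) g i y2 *: y1).
  transitivity (\sw_(x, y <- rho v) \sw_(x0, x1 <- rho x) g i y *: (x0 \ox x1)).
    rewrite (tsum_comp_lin _ _ (linearP rho)); apply: eq_tsum => y z.
    rewrite linearZ /= -{1}(tsum_pureE (rho y)).
    by rewrite (@tsum_comp_lin _ _ _ _ _ _ _ _ _ _ ( *:%R (g i z))) //; lin.
  rewrite rho_coassocE; try by move=> *; lin.
  rewrite ev tsum_sum_pure; last by bal.
  apply: eq_bigr => j _;
    rewrite [RHS](@tsum_comp_lin _ _ _ _ _ _ _ _ _ _ (fun y => e j \ox y)); last by lin.
  by apply: eq_tsum => y z; rewrite pureZr.
(* The [e i] may be linearly dependent. [b] is a basis of their span, and [bP] carries linear
   properties from the [e i] to the [b q]. *)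
have [m [b [f [fb bP be]]]] := dual_family [seq e i | i : 'I_n].
have {}be i : e i = \sum_q f q (e i) *: b q by apply: be; apply: codom_f.
have fE (d : 'I_m -> H) p : \sw_(x, y <- \sum_q b q \ox d q) f p x *: y = d p.
  rewrite tsum_sum_pure; last by bal.
  rewrite (bigD1 p) //= fb eqxx scale1r big1 ?addr0 // => q /negPf qp.
  by rewrite fb eq_sym qp scale0r.
have /choice[c cE] : forall q, exists d : 'I_m -> H, rho (b q) = \sum_p b p \ox d p.
  apply: (bP (fun y => exists d : 'I_m -> H, rho y = \sum_p b p \ox d p)) => [|y].
    split=> [|a x y [dx ex] [dy ey]].
      exists (fun=> 0); rewrite linear0 big1 // => p _.
      by apply: (addrI (b p \ox (0 : H))); rewrite -pureDr !addr0.
    exists (fun p => a *: dx p + dy p); rewrite linearP /= ex ey scaler_sumr.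
    by rewrite -big_split; apply: eq_bigr => p _; rewrite pureDr pureZr.
  move=> /codomP[i ->]; have [d ->] := re i.
  exists (fun p => \sum_j f p (e j) *: d j).
  under eq_bigr => j _ do rewrite be pure_suml.
  rewrite exchange_big; apply: eq_bigr => p _; rewrite pure_sumr.
  by apply: eq_bigr => j _; rewrite pureZl pureZr.
exists m, b, (fun p q => c q p), (fun q => f q v); split.
- split=> //; split=> p q.
    rewrite -[in LHS](fE (c q) p) -cE.
    rewrite (tsum_comp_lin _ _ (linearP Delta)).
    transitivity (\sw_(x, y <- rho (b q)) \Sw_(y1, y2 <- y) f p x *: (y1 \ox y2)).
      apply: eq_tsum => x y; rewrite linearZ /= -{1}(tsum_pureE (Delta y)).
      by rewrite (@tsum_comp_lin _ _ _ _ _ _ _ _ _ _ ( *:%R (f p x))) //; lin.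
    rewrite -rho_coassocE; try by move=> *; lin.
    rewrite cE tsum_sum_pure; last by bal.
    apply: eq_bigr => l _; rewrite -[in RHS](fE (c l) p) -cE.
    rewrite [RHS](@tsum_comp_lin _ _ _ _ _ _ _ _ _ _ (fun y => y \ox c q l));
      last by lin.
    by apply: eq_tsum => x y; rewrite pureZl.
  rewrite -fb -[in RHS](rho_counit (b q)) cE tsum_sum_pure; last by bal.
  rewrite linear_sum (bigD1 p) //= linearZ /= fb eqxx mulr1 big1 ?addr0 //.
  by move=> l /negPf lp; rewrite linearZ /= fb eq_sym lp mulr0.
- rewrite -[in LHS](rho_counit v) ev tsum_sum_pure; last by bal.
  have -> : v = \sum_i counit (h i) *: e i.
    by rewrite -[in LHS](rho_counit v) ev tsum_sum_pure //; bal.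
  under [LHS]eq_bigr => i _ do rewrite be scaler_sumr.
  rewrite exchange_big; apply: eq_bigr => p _.
  rewrite linear_sum scaler_suml; apply: eq_bigr => i _.
  by rewrite scalerA linearZ.
apply: (bP (fun u => exists g : {scalar H}, u = \sw_(y, z <- rho v) g z *: y))
  => [|_ /codomP[i ->]]; last by exists (g i).
split=> [|a x y [gx ->] [gy ->]].
  by exists (\0 : {scalar H}); rewrite /tsum big1 // => *; rewrite scale0r.
have aL : scalar (fun z => a * gx z + gy z).
  by move=> d z z'; rewrite !linearP; ring.
pose ga := HB.pack_for {scalar H} (fun z => a * gx z + gy z)
  (GRing.isLinear.Build k H k *%R _ aL).
exists ga.
rewrite /tsum scaler_sumr -big_split; apply: eq_bigr => p _ /=.
by rewrite scalerDl scalerA.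
Qed.
End Coordinates.

(** * Manipulation of nested sums *)

Section SumManip.
Variables (k : fieldType).

Lemma sum_deltal (W : lmodType k) (I : finType) (F : I -> W) i :
  \sum_j (i == j)%:R *: F j = F i.
Proof.
rewrite (bigD1 i) //= eqxx scale1r big1 ?addr0 // => j /negPf ji.
by rewrite eq_sym ji scale0r.
Qed.

Lemma sum_deltar (W : lmodType k) (I : finType) (F : I -> W) i :
  \sum_j (j == i)%:R *: F j = F i.
Proof. by under eq_bigr => j _ do rewrite eq_sym; apply: sum_deltal. Qed.

Lemma sum_pair (W : nmodType) (I J : finType) (F : I -> J -> W) :
  \sum_i \sum_j F i j = \sum_(p : I * J) F p.1 p.2.
Proof. exact: pair_bigA. Qed.
End SumManip.

(* On a goal "nested sum = ?R": instantiate ?R with the same sum in which the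
   n-th binder has been moved to the front. *)
Ltac pull n := lazymatch n with
  | O => reflexivity
  | S ?m => etransitivity; [apply: eq_bigr => ? _; pull m | apply: exchange_big]
  end.

(* On a goal "L = ?R": instantiate ?R with L after moving all scalars and pure
   tensors inside the sums. *)
Ltac distribute := cbv beta;
  rewrite ?(scaler_sumr, scaler_suml, mulr_sumr, mulr_suml, pure_suml, pure_sumr);
  lazymatch goal with
  | |- @bigop.body _ _ _ _ _ = _ =>
    etransitivity; [apply: eq_bigr => ? _; distribute | reflexivity]
  | |- _ => reflexivity
  end.

Ltac same_summand :=
  first [reflexivity | ring | rewrite ?scalerA; congr (_ *: _); ring].

Ltac match_front n tac :=
  etransitivity; [pull n|]; cbv beta; apply: eq_bigr => ? _; tac.

(* Backtracks over the bijections between the binders of the two sides. *)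
Ltac match_sums := cbv beta; lazymatch goal with
  | |- @bigop.body _ _ _ _ _ = @bigop.body _ _ _ _ _ =>
    first [ match_front 0%N match_sums | match_front 1%N match_sums
          | match_front 2%N match_sums | match_front 3%N match_sums
          | match_front 4%N match_sums | match_front 5%N match_sums
          | match_front 6%N match_sums ]
  | |- _ => same_summand
  end.

(* As match_sums, but l lists which remaining binder of the left-hand side
   corresponds to each of the first binders of the right-hand side. *)
Ltac match_sums_along l := cbv beta; lazymatch l with
  | nil => match_sums
  | cons ?n ?l' => match_front n ltac:(match_sums_along l')
  end.

Ltac einstein_along l :=
  etransitivity; [distribute|]; etransitivity; [|symmetry; distribute];
  match_sums_along l.

(* Equality of two nested sums up to distributivity and renaming of indices. *)
Ltac einstein := einstein_along (@nil nat).

(** * Coquasi-bialgebras in coordinates *)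

(* Extends lin to hypotheses of linearity in the context. *)
Ltac linh := cbv beta; unfold sw3, sw2; cbv beta; first
  [ match goal with h : _ |- _ => solve [apply: h] end
  | apply lin_tsum; intros ? ?; linh
  | apply lin_tsum_arg; [lin | apply: bil_balanced; split; intros ?; linh]
  | lin ].
Ltac bil := try apply: bil_balanced; split=> ?; linh.

Lemma comatrix_sw2 (k : fieldType) (H : coalgebra k) (I : finType)
    (c : I -> I -> H) (W : lmodType k) (F : H -> H -> W) i j :
  comatrix c -> bilinear F -> sw2 (c i j) F = \sum_l F (c i l) (c l j).
Proof.
by move=> [cD _] FB; rewrite /sw2 cD tsum_sum_pure //; apply: bil_balanced.
Qed.

Lemma comatrix_sw3 (k : fieldType) (H : coalgebra k) (I : finType)
    (c : I -> I -> H) (W : lmodType k) (F : H -> H -> H -> W) i j :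
  comatrix c -> (forall y z, linear (fun x => F x y z)) ->
  (forall x z, linear (fun y => F x y z)) -> (forall x y, linear (F x y)) ->
  sw3 (c i j) F = \sum_l \sum_m F (c i l) (c l m) (c m j).
Proof.
move=> cM F1 F2 F3; rewrite /sw3 comatrix_sw2 //.
  by apply: eq_bigr => l _; rewrite comatrix_sw2 //; bil.
by bil.
Qed.

Section Bialgebra.
Variables (k : fieldType) (H : coquasi_bialgebra k).
Local Notation "'1H'" := (hone H).
Local Notation "h ** g" := (hmul h g) (at level 40, left associativity).

Lemma comatrix_mul (I J : finType) (c : I -> I -> H) (d : J -> J -> H) :
  comatrix c -> comatrix d ->
  comatrix (fun p q : I * J => c p.1 q.1 ** d p.2 q.2).
Proof.
move=> cM dM; split=> [p q|p q]; last first.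
  by rewrite counit_mul cM.2 dM.2 -natrM mulnb -pair_eqE.
rewrite Delta_mul comatrix_sw2 //; last by bil.
under eq_bigr => l _ do (rewrite comatrix_sw2 //; last by bil).
exact: sum_pair.
Qed.

Section Triple.
Variables (I J L : finType) (c : I -> I -> H) (d : J -> J -> H) (e : L -> L -> H).
Hypotheses (cM : comatrix c) (dM : comatrix d) (eM : comatrix e).

Lemma comatrix_tri (W : lmodType k) (F : H -> H -> H -> H -> H -> H -> W)
   i j l i2 j2 l2 :
  (forall x y z x' y', linear (F x y z x' y')) ->
  (forall x y z x' z', linear (fun y' => F x y z x' y' z')) ->
  (forall x y z y' z', linear (fun x' => F x y z x' y' z')) ->
  (forall x y x' y' z', linear (fun z => F x y z x' y' z')) ->
  (forall x z x' y' z', linear (fun y => F x y z x' y' z')) ->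
  (forall y z x' y' z', linear (fun x => F x y z x' y' z')) ->
  \Sw_(h1, h2 <- c i i2) \Sw_(g1, g2 <- d j j2) \Sw_(x1, x2 <- e l l2)
    F h1 g1 x1 h2 g2 x2 =
  \sum_i' \sum_j' \sum_l' F (c i i') (d j j') (e l l')
                            (c i' i2) (d j' j2) (e l' l2).
Proof.
move=> *; rewrite comatrix_sw2 //; last by bil.
apply: eq_bigr => i' _; rewrite comatrix_sw2 //; last by bil.
by apply: eq_bigr => j' _; rewrite comatrix_sw2 //; bil.
Qed.

Lemma comatrix_omegaVK i j l i2 j2 l2 :
  \sum_i' \sum_j' \sum_l' omegaV (c i i') (d j j') (e l l') *
    omega (c i' i2) (d j' j2) (e l' l2) =
  (i == i2)%:R * (j == j2)%:R * (l == l2)%:R.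
Proof.
rewrite -cM.2 -dM.2 -eM.2 -omegaVK (@comatrix_tri k^o) //; move=> *; lin.
Qed.

Lemma comatrix_omegaK i j l i2 j2 l2 :
  \sum_i' \sum_j' \sum_l' omega (c i i') (d j j') (e l l') *
    omegaV (c i' i2) (d j' j2) (e l' l2) =
  (i == i2)%:R * (j == j2)%:R * (l == l2)%:R.
Proof.
rewrite -cM.2 -dM.2 -eM.2 -omegaK (@comatrix_tri k^o) //; move=> *; lin.
Qed.

Lemma comatrix_hmulA i j l i2 j2 l2 :
  \sum_i' \sum_j' \sum_l' omega (c i' i2) (d j' j2) (e l' l2) *:
    (c i i' ** (d j j' ** e l l')) =
  \sum_i' \sum_j' \sum_l' omega (c i i') (d j j') (e l l') *:
    ((c i' i2 ** d j' j2) ** e l' l2).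
Proof.
have := hmulA (c i i2) (d j j2) (e l l2).
rewrite comatrix_tri; try by move=> *; lin.
by rewrite comatrix_tri //; move=> *; lin.
Qed.
End Triple.

End Bialgebra.

(** * Matrices of scalars, the coordinate form of convolution *)

Section FunctionMatrices.
Variables (k : fieldType) (T : finType).
Implicit Types F G K : T -> T -> k.

(** Evaluation on comatrices turns convolution of functionals into this product; [omega] and
    [omegaV] become inverse matrices indexed by triples. *)
Definition fmul F G p q := \sum_r F p r * G r q.

Lemma fmulA F G K p q : fmul (fmul F G) K p q = fmul F (fmul G K) p q.
Proof. rewrite /fmul; einstein. Qed.

Lemma eq_fmul F F' G G' : (forall p q, F p q = F' p q) ->
  (forall p q, G p q = G' p q) -> forall p q, fmul F G p q = fmul F' G' p q.
Proof. by move=> FF GG p q; apply: eq_bigr => r _; rewrite FF GG. Qed.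

Definition fone (p q : T) : k := (p == q)%:R.

Lemma fmul1l F p q : fmul fone F p q = F p q.
Proof. exact: (@sum_deltal _ k^o). Qed.

Lemma fmul1r F p q : fmul F fone p q = F p q.
Proof.
by rewrite -[RHS](@sum_deltar _ k^o _ (F p)); apply: eq_bigr => r _; rewrite mulrC.
Qed.

(* With G inverse to F, this turns L F = F R into R G = G L. *)
Lemma fmul_shift (W : lmodType k) F G (L R : T -> T -> W) :
  (forall p q, fmul F G p q = fone p q) -> (forall p q, fmul G F p q = fone p q) ->
  (forall p r, \sum_q F q r *: L p q = \sum_q F p q *: R q r) ->
  forall p r, \sum_q G q r *: R p q = \sum_q G p q *: L q r.
Proof.
move=> FG GF e p r;
  transitivity (\sum_q \sum_s \sum_t (G p t * F t s * G q r) *: R s q).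
  apply: eq_bigr => q _; rewrite -[R p q](sum_deltal (R^~ q)) scaler_sumr.
  apply: eq_bigr => s _; rewrite -/(fone p s) -GF /fmul; einstein.
transitivity (\sum_q \sum_t (G p t * G q r) *: \sum_s F t s *: R s q);
  first by einstein.
under eq_bigr => q _ do under eq_bigr => t _ do rewrite -e.
transitivity (\sum_t G p t *: \sum_s (fmul F G s r) *: L t s);
  first by rewrite /fmul; einstein.
apply: eq_bigr => t _; congr (_ *: _); rewrite -[RHS](sum_deltar (L t)).
by apply: eq_bigr => s _; rewrite FG.
Qed.
End FunctionMatrices.

Section Bialgebra.
Variables (k : fieldType) (H : coquasi_bialgebra k).
Local Notation "'1H'" := (hone H).
Local Notation "h ** g" := (hmul h g) (at level 40, left associativity).

Section Triple.
Variables (I J L : finType) (c : I -> I -> H) (d : J -> J -> H) (e : L -> L -> H).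
Hypotheses (cM : comatrix c) (dM : comatrix d) (eM : comatrix e).

Lemma sum_triple (W : nmodType) (F : I -> J -> L -> W) :
  \sum_i \sum_j \sum_l F i j l = \sum_(p : I * J * L) F p.1.1 p.1.2 p.2.
Proof. by rewrite sum_pair sum_pair. Qed.

(** [fmul_shift] applied to [comatrix_hmulA], a triple of indices serving as one matrix index. *)
Lemma comatrix_hmulAV i j l i2 j2 l2 :
  \sum_i' \sum_j' \sum_l' omegaV (c i' i2) (d j' j2) (e l' l2) *:
    ((c i i' ** d j j') ** e l l') =
  \sum_i' \sum_j' \sum_l' omegaV (c i i') (d j j') (e l l') *:
    (c i' i2 ** (d j' j2 ** e l' l2)).
Proof.
rewrite !sum_triple.
apply: (@fmul_shift _ _ _
   (fun p q => omega (c p.1.1 q.1.1) (d p.1.2 q.1.2) (e p.2 q.2))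
   (fun p q => omegaV (c p.1.1 q.1.1) (d p.1.2 q.1.2) (e p.2 q.2))
   (fun p q => c p.1.1 q.1.1 ** (d p.1.2 q.1.2 ** e p.2 q.2))
   (fun p q => (c p.1.1 q.1.1 ** d p.1.2 q.1.2) ** e p.2 q.2) _ _ _
   (i, j, l) (i2, j2, l2)) => [p q|p q|p q].
- have := comatrix_omegaK cM dM eM p.1.1 p.1.2 p.2 q.1.1 q.1.2 q.2.
  by rewrite sum_triple /fmul /fone => ->; rewrite -!natrM !mulnb -!pair_eqE.
- have := comatrix_omegaVK cM dM eM p.1.1 p.1.2 p.2 q.1.1 q.1.2 q.2.
  by rewrite sum_triple /fmul /fone => ->; rewrite -!natrM !mulnb -!pair_eqE.
- have := comatrix_hmulA cM dM eM p.1.1 p.1.2 p.2 q.1.1 q.1.2 q.2.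
  by rewrite !sum_triple.
Qed.
End Triple.

Section Quadruple.
Variables (I J L N : finType) (c : I -> I -> H) (d : J -> J -> H)
  (e : L -> L -> H) (f : N -> N -> H).
Hypotheses (cM : comatrix c) (dM : comatrix d) (eM : comatrix e) (fM : comatrix f).

Lemma comatrix_cocycle i j l n i2 j2 l2 n2 :
  \sum_i' \sum_j' \sum_l' \sum_n'
    omega (c i i') (d j j') (e l l' ** f n n') *
    omega (c i' i2 ** d j' j2) (e l' l2) (f n' n2) =
  \sum_i' \sum_j' \sum_j'' \sum_l' \sum_l'' \sum_n'
    omega (d j j') (e l l') (f n n') *
    omega (c i i') (d j' j'' ** e l' l'') (f n' n2) *
    omega (c i' i2) (d j'' j2) (e l'' l2).
Proof.
have := omega_cocycle (c i i2) (d j j2) (e l l2) (f n n2).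
rewrite (@comatrix_sw2 _ _ _ _ k^o) //; last by bil.
rewrite (@comatrix_sw2 _ _ _ _ k^o) //; last by bil.
(* [E] allows the two sides of the cocycle axiom to be expanded as separate goals. *)
have E : forall x y : k, x = y -> forall x' y', x = x' -> y = y' -> x' = y'.
  by move=> x y -> x' y' <- <-.
move/E; apply; apply: eq_bigr => i' _.
  rewrite (@comatrix_sw2 _ _ _ _ k^o) //; last by bil.
  apply: eq_bigr => j' _.
  rewrite (@comatrix_sw2 _ _ _ _ k^o) //; last by bil.
  apply: eq_bigr => l' _.
  by rewrite (@comatrix_sw2 _ _ _ _ k^o) //; last by bil.
rewrite (@comatrix_sw3 _ _ _ _ k^o) //; try by move=> *; lin.
apply: eq_bigr => j' _; apply: eq_bigr => j'' _.
rewrite (@comatrix_sw3 _ _ _ _ k^o) //; try by move=> *; lin.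
apply: eq_bigr => l' _; apply: eq_bigr => l'' _.
by rewrite (@comatrix_sw2 _ _ _ _ k^o) //; last by bil.
Qed.

End Quadruple.
End Bialgebra.

Lemma mul_sum_deltar (k : fieldType) (I : finType) (F G : I -> k) i :
  \sum_j F j * ((j == i)%:R * G j) = F i * G i.
Proof.
rewrite -[RHS](@sum_deltar _ k^o _ (fun j => F j * G j)).
by apply: eq_bigr => j _; rewrite mulrCA.
Qed.

Lemma mulr_deltar (k : fieldType) (I : finType) (F : I -> k) i :
  \sum_j F j * (j == i)%:R = F i.
Proof.
rewrite -[RHS](@sum_deltar _ k^o _ F).
by apply: eq_bigr => j _; rewrite mulrC.
Qed.

Lemma mull_deltal (k : fieldType) (I : finType) (F : I -> k) i :
  \sum_j (i == j)%:R * F j = F i.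
Proof. exact: (@sum_deltal _ k^o). Qed.

Section Bialgebra.
Variables (k : fieldType) (H : coquasi_bialgebra k).
Local Notation "'1H'" := (hone H).
Local Notation "h ** g" := (hmul h g) (at level 40, left associativity).

Lemma comatrix_one : comatrix (fun _ _ : unit => 1H).
Proof.
split=> [i j|[] []]; last by rewrite counit1.
by rewrite Delta1 (bigD1 tt) //= big1 ?addr0 // => -[].
Qed.

Lemma sum_unit (W : nmodType) (F : unit -> W) : \sum_u F u = F tt.
Proof. by rewrite (bigD1 tt) //= big1 ?addr0 // => -[]. Qed.

Section OmegaOne.
Variables (I J : finType) (c : I -> I -> H) (d : J -> J -> H).
Hypotheses (cM : comatrix c) (dM : comatrix d).

(** The cocycle identity with its last two entries equal to 1 shows that the matrix [E] of omega(-,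
    -, 1) is idempotent. Since [E'] is its inverse, [E] is the identity, and so is [E']. *)
Lemma comatrix_omegaV1r i j i2 j2 :
  omegaV (c i i2) (d j j2) 1H = (i == i2)%:R * (j == j2)%:R.
Proof.
pose E (p q : I * J) := omega (c p.1 q.1) (d p.2 q.2) 1H.
pose E' (p q : I * J) := omegaV (c p.1 q.1) (d p.2 q.2) 1H.
have EE' p q : fmul E E' p q = fone k p q.
  have := comatrix_omegaK cM dM comatrix_one p.1 p.2 tt q.1 q.2 tt.
  under eq_bigr => i' _ do under eq_bigr => j' _ do rewrite sum_unit.
  by rewrite sum_pair /fmul /fone => ->; rewrite -!natrM !mulnb andbT -!pair_eqE.
have EE p q : fmul E E p q = E p q.
  have := comatrix_cocycle cM dM comatrix_one comatrix_one p.1 p.2 tt tt q.1 q.2 tt tt.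
  have w11 x : omega x 1H 1H = counit x by rewrite omega1 counit1 mulr1.
  under eq_bigr => i' _.
    under eq_bigr => j' _ do
      rewrite !sum_unit hmul1l w11 counit_mul cM.2 dM.2 mulrA.
    rewrite mulr_deltar; over.
  rewrite mulr_deltar -/(E p q) => ->.
  rewrite /fmul -(sum_pair (fun i' j' => E p (i', j') * E (i', j') q)).
  apply: eq_bigr => i' _.
  under [RHS]eq_bigr => j' _.
    under eq_bigr => j'' _ do
      rewrite !sum_unit w11 dM.2 hmul1r -mulrA.
    rewrite -mulr_sumr; over.
  by rewrite mull_deltal.
have E1 p q : E p q = fone k p q.
  rewrite -EE' -[LHS]fmul1r -(eq_fmul (fun _ _ => erefl) EE') -fmulA.
  exact: eq_fmul.
transitivity (E' (i, j) (i2, j2)) => //.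
rewrite -[LHS]fmul1l -(eq_fmul E1 (fun _ _ => erefl)) EE'.
by rewrite -natrM mulnb.
Qed.
End OmegaOne.

Section Quadruple.
Variables (I J L N : finType) (c : I -> I -> H) (d : J -> J -> H)
  (e : L -> L -> H) (f : N -> N -> H).
Hypotheses (cM : comatrix c) (dM : comatrix d) (eM : comatrix e) (fM : comatrix f).

Let T : finType := (I * J * L * N)%type.

Lemma sum_quadruple (W : nmodType) (F : T -> W) :
  \sum_p F p = \sum_i \sum_j \sum_l \sum_n F (i, j, l, n).
Proof. by rewrite !sum_pair; apply: eq_bigr => -[[[? ?] ?] ?]. Qed.

(* The cocycle identity with the last factor omega(h_2, g_3, x_3) and the first
   factor omega(h_1, g_1, x_1 y_1) moved to the other sides. *)
Lemma comatrix_cocycleV i j l n i2 j2 l2 n2 :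
  \sum_i' \sum_j' \sum_l'
    omega (c i i' ** d j j') (e l l') (f n n2) *
    omegaV (c i' i2) (d j' j2) (e l' l2) =
  \sum_i' \sum_j' \sum_l' \sum_n' \sum_j'' \sum_l'' \sum_n''
    omegaV (c i i') (d j j') (e l l' ** f n n') *
    (omega (d j' j'') (e l' l'') (f n' n'') *
    omega (c i' i2) (d j'' j2 ** e l'' l2) (f n'' n2)).
Proof.
pose X1 (p q : T) := omega (c p.1.1.1 q.1.1.1) (d p.1.1.2 q.1.1.2)
                         (e p.1.2 q.1.2 ** f p.2 q.2).
pose X1' (p q : T) := omegaV (c p.1.1.1 q.1.1.1) (d p.1.1.2 q.1.1.2)
                         (e p.1.2 q.1.2 ** f p.2 q.2).
pose X2 (p q : T) := omega (c p.1.1.1 q.1.1.1 ** d p.1.1.2 q.1.1.2)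
                         (e p.1.2 q.1.2) (f p.2 q.2).
pose Y (p q : T) := \sum_j' \sum_l' \sum_n'
   omega (d p.1.1.2 j') (e p.1.2 l') (f p.2 n') *
   omega (c p.1.1.1 q.1.1.1) (d j' q.1.1.2 ** e l' q.1.2) (f n' q.2).
(* The last factor of the cocycle identity does not involve [f]; a Kronecker delta extends it to a
   matrix on quadruples, with inverse [Z']. *)
pose Z (p q : T) := (p.2 == q.2)%:R * omega (c p.1.1.1 q.1.1.1)
                    (d p.1.1.2 q.1.1.2) (e p.1.2 q.1.2).
pose Z' (p q : T) := (p.2 == q.2)%:R * omegaV (c p.1.1.1 q.1.1.1)
                    (d p.1.1.2 q.1.1.2) (e p.1.2 q.1.2).
have XX p q : fmul X1' X1 p q = fone k p q.
  have := comatrix_omegaVK cM dM (comatrix_mul eM fM)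
     p.1.1.1 p.1.1.2 (p.1.2, p.2) q.1.1.1 q.1.1.2 (q.1.2, q.2).
  rewrite /fmul sum_quadruple.
  under [X in _ -> X = _]eq_bigr => i' _ do under eq_bigr => j' _ do rewrite sum_pair.
  move=> ->; by rewrite -!natrM !mulnb /fone -!pair_eqE /= -!pair_eqE /= !andbA.
have ZZ p q : fmul Z Z' p q = fone k p q.
  have := comatrix_omegaK cM dM eM
     p.1.1.1 p.1.1.2 p.1.2 q.1.1.1 q.1.1.2 q.1.2.
  rewrite /fmul sum_quadruple /Z /Z' /= => E.
  transitivity (\sum_i' \sum_j' \sum_l' (omega (c p.1.1.1 i') (d p.1.1.2 j') (e p.1.2 l') *
     omegaV (c i' q.1.1.1) (d j' q.1.1.2) (e l' q.1.2)) * (p.2 == q.2)%:R).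
    apply: eq_bigr => i' _; apply: eq_bigr => j' _; apply: eq_bigr => l' _.
    set w := _ * omegaV _ _ _.
    rewrite -[RHS](mulr_deltar (fun n => w * (p.2 == n)%:R)).
    by apply: eq_bigr => n' _; rewrite /w; ring.
  under eq_bigr => i' _ do (under eq_bigr => j' _ do rewrite -mulr_suml; rewrite -mulr_suml).
  by rewrite -mulr_suml E -!natrM !mulnb /fone -!pair_eqE /= -!pair_eqE /=.
have XY p q : fmul X1 X2 p q = fmul Y Z p q.
  have := comatrix_cocycle cM dM eM fM p.1.1.1 p.1.1.2 p.1.2 p.2 
     q.1.1.1 q.1.1.2 q.1.2 q.2.
  rewrite /fmul !sum_quadruple /X1 /X2 /= => ->.
  apply: eq_bigr => i' _.
  transitivity (\sum_j'' \sum_l'' Y p (i', j'', l'', q.2) * omega (c i' q.1.1.1)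
                    (d j'' q.1.1.2) (e l'' q.1.2)).
    by rewrite /Y /=; einstein.
  apply: eq_bigr => j' _; apply: eq_bigr => l' _.
  rewrite -[LHS](mul_sum_deltar (fun n' => Y p (i', j', l', n'))
    (fun _ => omega (c i' q.1.1.1) (d j' q.1.1.2) (e l' q.1.2))).
  by apply: eq_bigr => n' _.
(* With [XY], the product X1 X2 equals Y Z; multiplying by [X1'] on the left and [Z'] on the right
   gives X2 Z' = X1' Y. *)
pose p : T := (i, j, l, n); pose q : T := (i2, j2, l2, n2).
transitivity (fmul X2 Z' p q).
  rewrite /fmul !sum_quadruple; apply: eq_bigr => i' _; apply: eq_bigr => j' _.
  apply: eq_bigr => l' _;
    rewrite -[LHS](mul_sum_deltar (fun n' => X2 p (i', j', l', n'))
    (fun _ => omegaV (c i' i2) (d j' j2) (e l' l2))).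
  by apply: eq_bigr => n' _.
transitivity (fmul X1' Y p q); last first.
  by rewrite /fmul sum_quadruple /X1' /Y /=; einstein.
transitivity (fmul (fmul X1' X1) (fmul X2 Z') p q).
  rewrite -[LHS]fmul1l; apply: eq_fmul => // p' q'; by rewrite XX.
rewrite fmulA -[RHS]fmul1r -[RHS](eq_fmul (fun _ _ => erefl) ZZ).
rewrite [RHS]fmulA; apply: eq_fmul => // p' q'.
rewrite -!fmulA; exact: eq_fmul.
Qed.
End Quadruple.
End Bialgebra.

(** * Antipode, alpha and beta in coordinates *)

Lemma comatrix_sw4 (k : fieldType) (H : coalgebra k) (I : finType)
    (c : I -> I -> H) (W : lmodType k) (F : H -> H -> H -> H -> W) i j :
  comatrix c -> (forall y z t, linear (fun x => F x y z t)) ->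
  (forall x z t, linear (fun y => F x y z t)) ->
  (forall x y t, linear (fun z => F x y z t)) ->
  (forall x y z, linear (F x y z)) ->
  sw4 (c i j) F =
  \sum_l \sum_m \sum_n F (c i l) (c l m) (c m n) (c n j).
Proof.
move=> cM F1 F2 F3 F4; rewrite /sw4 comatrix_sw2 //; last by bil.
by apply: eq_bigr => l _; rewrite comatrix_sw3 //.
Qed.

Lemma comatrix_sw5 (k : fieldType) (H : coalgebra k) (I : finType)
    (c : I -> I -> H) (W : lmodType k) (F : H -> H -> H -> H -> H -> W) i j :
  comatrix c -> (forall y z t u, linear (fun x => F x y z t u)) ->
  (forall x z t u, linear (fun y => F x y z t u)) ->
  (forall x y t u, linear (fun z => F x y z t u)) ->
  (forall x y z u, linear (fun t => F x y z t u)) ->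
  (forall x y z t, linear (F x y z t)) ->
  sw5 (c i j) F =
  \sum_l \sum_m \sum_n \sum_o F (c i l) (c l m) (c m n) (c n o) (c o j).
Proof.
move=> cM F1 F2 F3 F4 F5; rewrite /sw5 comatrix_sw2 //; last by bil.
by apply: eq_bigr => l _; rewrite comatrix_sw4 //.
Qed.

Section Hopf.
Variables (k : fieldType) (H : coquasi_hopf k).
Local Notation "'1H'" := (hone H).
Local Notation "h ** g" := (hmul h g) (at level 40, left associativity).
Local Notation S := (@antipode k H).

Lemma antipode1 : S 1H = 1H.
Proof.
have := antipode_alpha 1H; rewrite /sw3 sw2_one; last by bil.
by rewrite sw2_one ?alpha1 ?scale1r ?hmul1r //; bil.
Qed.

Section Comatrix.
Variables (I : finType) (c : I -> I -> H).
Hypothesis cM : comatrix c.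

Lemma comatrix_antipode : comatrix (fun i j => S (c j i)).
Proof.
split=> i j; last by rewrite counit_antipode cM.2 eq_sym.
by rewrite Delta_antipode comatrix_sw2 //; bil.
Qed.

Lemma comatrix_beta (W : lmodType k) (F : H -> W) i j : linear F ->
  \sum_a \sum_b beta (c a b) *: F (c i a ** S (c b j)) = beta (c i j) *: F 1H.
Proof.
move=> FL; rewrite -(lin_Z _ _ FL) -antipode_beta comatrix_sw3 //; try by move=> *; lin.
rewrite (lin_sum _ FL); apply: eq_bigr => a _; rewrite (lin_sum _ FL).
by apply: eq_bigr => b _; rewrite (bilZl (hmul_bilinear H)) (lin_Z _ _ FL).
Qed.

Lemma comatrix_alpha (W : lmodType k) (F : H -> W) i j : linear F ->
  \sum_a \sum_b alpha (c a b) *: F (S (c i a) ** c b j) = alpha (c i j) *: F 1H.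
Proof.
move=> FL; rewrite -(lin_Z _ _ FL) -antipode_alpha comatrix_sw3 //; try by move=> *; lin.
rewrite (lin_sum _ FL); apply: eq_bigr => a _; rewrite (lin_sum _ FL).
by apply: eq_bigr => b _; rewrite (bilZr (hmul_bilinear H)) (lin_Z _ _ FL).
Qed.

Lemma comatrix_omega_antipode i j :
  \sum_a \sum_b \sum_d \sum_e (beta (c a b) * alpha (c d e)) *
     omega (c i a) (S (c b d)) (c e j) = (i == j)%:R.
Proof.
rewrite -cM.2 -omega_antipode (@comatrix_sw5 _ _ _ _ k^o) //; try by move=> *; lin.
have [w1 w2 w3] := omega_trilinear H.
apply: eq_bigr => a _; apply: eq_bigr => b _; apply: eq_bigr => d _.
apply: eq_bigr => e _.
by rewrite (lin_Z (W := k^o) _ _ (w1 _ _)) (lin_Z (W := k^o) _ _ (w3 _ _)) /= -mulrA.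
Qed.
End Comatrix.

(** This form and the next two are the weights under which cancellations such as g_1 (S(g_2) r) =
    eps(g) r survive without associativity; for a Hopf algebra with trivial [omega], [alpha] and
    [beta] all three are eps (x) eps. [omegaV_beta] is the weight occurring in [can]. *)
Definition omega_beta (g r : H) : k :=
  \Sw_(g1, g2, g3 <- g) beta g2 * omega g1 (S g3) r.

Lemma omega_beta_bilinear : bilinear (omega_beta : H -> H -> k^o).
Proof. by rewrite /omega_beta; split=> ?; lin. Qed.

Definition omegaV_beta (l r : H) : k :=
  \Sw_(r1, r2, r3 <- r) beta r2 * omegaV l r1 (S r3).

Lemma omegaV_beta_bilinear : bilinear (omegaV_beta : H -> H -> k^o).
Proof. by rewrite /omegaV_beta; split=> ?; lin. Qed.

Definition omega_alpha (a h : H) : k :=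
  \Sw_(h1, h2, h3 <- h) alpha h2 * omega a (S h1) h3.

Lemma omega_alpha_bilinear : bilinear (omega_alpha : H -> H -> k^o).
Proof. by rewrite /omega_alpha; split=> ?; lin. Qed.

Section Comatrices.
Variables (I J : finType) (c : I -> I -> H) (r : J -> J -> H).
Hypotheses (cM : comatrix c) (rM : comatrix r).

Lemma comatrix_omega_beta i j x :
  omega_beta (c i j) x = \sum_a \sum_b beta (c a b) * omega (c i a) (S (c b j)) x.
Proof. by rewrite /omega_beta (@comatrix_sw3 _ _ _ _ k^o) //; move=> *; lin. Qed.

Lemma comatrix_omegaV_beta x s t :
  omegaV_beta x (r s t) = \sum_a \sum_b beta (r a b) * omegaV x (r s a) (S (r b t)).
Proof. by rewrite /omegaV_beta (@comatrix_sw3 _ _ _ _ k^o) //; move=> *; lin. Qed.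

Lemma comatrix_omega_alpha x s t :
  omega_alpha x (r s t) = \sum_a \sum_b alpha (r a b) * omega x (S (r s a)) (r b t).
Proof. by rewrite /omega_alpha (@comatrix_sw3 _ _ _ _ k^o) //; move=> *; lin. Qed.

Lemma omega_beta_alpha i j :
  \sum_a \sum_b alpha (c a b) * omega_beta (c i a) (c b j) = (i == j)%:R.
Proof.
rewrite -(comatrix_omega_antipode cM).
under eq_bigr => a _ do under eq_bigr => b _ do rewrite comatrix_omega_beta.
einstein.
Qed.

(** In Sweedler form: omega_beta(g_2, r_2) g_1 (S(g_3) r_1) = omega_beta(g, r_1) r_2. Reassociation
    through [comatrix_hmulA] brings g_1 and S(g_3) together, and the antipode axiom for [beta]
    removes them. *)
Lemma omega_beta_assoc i j s t :
  \sum_a \sum_b \sum_u omega_beta (c a b) (r u t) *: (c i a ** (S (c b j) ** r s u)) =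
  \sum_u omega_beta (c i j) (r s u) *: r u t.
Proof.
under eq_bigr => a _ do under eq_bigr => b _ do
  under eq_bigr => u _ do rewrite comatrix_omega_beta.
transitivity (\sum_a' \sum_b' beta (c a' b') *: 
   \sum_a \sum_b \sum_u omega (c a a') (S (c b' b)) (r u t) *:
    (c i a ** (S (c b j) ** r s u))); first by einstein.
under eq_bigr => a' _ do under eq_bigr => b' _ do
  rewrite (comatrix_hmulA cM (comatrix_antipode cM) rM).
transitivity (\sum_a \sum_b \sum_u omega (c i a) (S (c b j)) (r s u) *:
   \sum_a' \sum_b' beta (c a' b') *: ((c a a' ** S (c b' b)) ** r u t));
     first by einstein.
under eq_bigr => a _ do under eq_bigr => b _ do under eq_bigr => u _ do
  (rewrite (comatrix_beta cM (F := fun h => h ** r u t)); last by lin).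
under [RHS]eq_bigr => u _ do rewrite comatrix_omega_beta.
under eq_bigr => a _ do under eq_bigr => b _ do under eq_bigr => u _ do
 rewrite hmul1l.
einstein.
Qed.

(** The mirror image: omegaV_beta(l_2, r_2) (l_1 r_1) S(r_3) = omegaV_beta(l_1, r) l_2, by
    [comatrix_hmulAV]. *)
Lemma omegaV_beta_assoc i j s t :
  \sum_m \sum_a \sum_b omegaV_beta (c m j) (r a b) *: ((c i m ** r s a) ** S (r b t)) =
  \sum_m omegaV_beta (c i m) (r s t) *: c m j.
Proof.
under eq_bigr => m _ do under eq_bigr => a _ do
  under eq_bigr => b _ do rewrite comatrix_omegaV_beta.
transitivity (\sum_a' \sum_b' beta (r a' b') *:
  \sum_m \sum_a \sum_b omegaV (c m j) (r a a') (S (r b' b)) *: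
   ((c i m ** r s a) ** S (r b t))); first by einstein.
under eq_bigr => a' _ do under eq_bigr => b' _ do
  rewrite (comatrix_hmulAV cM rM (comatrix_antipode rM)).
transitivity (\sum_m \sum_a \sum_b omegaV (c i m) (r s a) (S (r b t)) *:
  \sum_a' \sum_b' beta (r a' b') *: (c m j ** (r a a' ** S (r b' b))));
    first by einstein.
under eq_bigr => m _ do under eq_bigr => a _ do under eq_bigr => b _ do
  (rewrite (comatrix_beta rM (F := fun h => c m j ** h)); last by lin).
under [RHS]eq_bigr => m _ do rewrite comatrix_omegaV_beta.
under eq_bigr => m _ do under eq_bigr => a _ do under eq_bigr => b _ do
 rewrite hmul1r.
einstein.
Qed.

Lemma omega_alpha1l s t : omega_alpha 1H (r s t) = alpha (r s t).
Proof.
rewrite comatrix_omega_alpha.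
under eq_bigr => a _ do under eq_bigr => b _ do
  rewrite omega1l counit_antipode !rM.2 mulrA.
under eq_bigr => a _ do rewrite mulr_deltar mulrC.
exact: mull_deltal.
Qed.

(** The cocycle identity [comatrix_cocycleV] for the arguments l, r, S(r), r. The antipode axioms
    collapse two of the resulting factors ([eA], [eB]) to values of [omegaV] and [omega] with an
    argument 1; what is left is the normalization of [omega] by [alpha] and [beta]. *)
Lemma omega_alpha_omegaV_beta i j s t :
  \sum_m \sum_a \sum_b omega_alpha (c i m ** r s a) (r b t) * omegaV_beta (c m j) (r a b) =
  (i == j)%:R * (s == t)%:R.
Proof.
under eq_bigr => m _ do under eq_bigr => a _ do under eq_bigr => b _ do
  rewrite comatrix_omega_alpha comatrix_omegaV_beta.
have dM := comatrix_antipode rM.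
transitivity (\sum_u \sum_v \sum_q \sum_d (alpha (r u v) * beta (r q d)) *
  \sum_m \sum_a \sum_b omega (c i m ** r s a) (S (r b u)) (r v t) *
    omegaV (c m j) (r a q) (S (r d b))); first by einstein_along [:: 5; 5; 3; 3]%N.
under eq_bigr => u _ do under eq_bigr => v _ do under eq_bigr => q _ do
  under eq_bigr => d _ do rewrite (comatrix_cocycleV cM rM dM rM).
transitivity (\sum_m \sum_a \sum_a' \sum_x \sum_x' \sum_y \sum_y'
   (omega (r a a') (S (r x' x)) (r y y')) *
   ((\sum_u \sum_v alpha (r u v) * omegaV (c i m) (r s a) (S (r x u) ** r v y)) *
   (\sum_q \sum_d beta (r q d) * omega (c m j) (r a' q ** S (r d x')) (r y' t)))).
  einstein_along [:: 4; 4; 6; 4; 5; 4; 4]%N.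
have eA m a x y : \sum_u \sum_v alpha (r u v) *
    omegaV (c i m) (r s a) (S (r x u) ** r v y) =
    alpha (r x y) * ((i == m)%:R * (s == a)%:R).
  rewrite (comatrix_alpha rM (W := k^o) (F := fun h => omegaV (c i m) (r s a) h)).
    by rewrite (comatrix_omegaV1r cM rM).
  by lin.
have eB m a' x' y' : \sum_q \sum_d beta (r q d) *
    omega (c m j) (r a' q ** S (r d x')) (r y' t) =
    beta (r a' x') * ((m == j)%:R * (y' == t)%:R).
  rewrite (comatrix_beta rM (W := k^o) (F := fun h => omega (c m j) h (r y' t))).
    by rewrite omega1 cM.2 rM.2.
  by lin.
transitivity (\sum_m (i == m)%:R * ((m == j)%:R * \sum_a (s == a)%:R *
   \sum_a' \sum_x \sum_x' \sum_y \sum_y' (omega (r a a') (S (r x' x)) (r y y') *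
     (alpha (r x y) * beta (r a' x'))) * (y' == t)%:R)).
  under eq_bigr => m _ do under eq_bigr => a _ do under eq_bigr => a' _ do
    under eq_bigr => x _ do under eq_bigr => x' _ do under eq_bigr => y _ do
    under eq_bigr => y' _ do rewrite eA eB.
  einstein.
rewrite mull_deltal mull_deltal; congr (_ * _).
rewrite -(comatrix_omega_antipode rM).
under eq_bigr => a' _ do under eq_bigr => x _ do under eq_bigr => x' _ do
  under eq_bigr => y _ do rewrite mulr_deltar.
einstein.
Qed.
End Comatrices.
End Hopf.
#[global] Hint Resolve omega_beta_bilinear omegaV_beta_bilinear omega_alpha_bilinear : bilin.

(** * The maps attached to a relative Hopf module *)

Section CoordinateCalculus.
Variables (k : fieldType) (H : coalgebra k).

Lemma coordinates_tsum (V : comodule H) (I : finType) (b : I -> V)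
    (c : I -> I -> H) (W : lmodType k) (F : V -> H -> W) i :
  coordinates b c -> bilinear F -> tsum (rho (b i)) F = \sum_j F (b j) (c j i).
Proof.
by move=> [_ e] FB; rewrite e tsum_sum_pure //; apply: bil_balanced.
Qed.

Lemma eq_on_coordinates (V : comodule H) (W : lmodType k) (F G : V -> W) :
  linear F -> linear G ->
  (forall n (b : 'I_n -> V) c, coordinates b c -> forall i, F (b i) = G (b i)) ->
  forall v, F v = G v.
Proof.
move=> FL GL FG v; have [n [b [c [x [bc -> _]]]]] := coordinates_exist v.
rewrite (lin_sum _ FL) (lin_sum _ GL); apply: eq_bigr => i _.
by rewrite (lin_Z _ _ FL) (lin_Z _ _ GL) (FG _ _ _ bc).
Qed.

(** By the left counit axiom, basis vectors of a subcomodule of [H] are combinations of its matrix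
    coefficients. *)
Lemma eq_on_comatrices (W : lmodType k) (F G : H -> W) :
  linear F -> linear G ->
  (forall n (c : 'I_n -> 'I_n -> H), comatrix c ->
    forall i j, F (c i j) = G (c i j)) ->
  forall h, F h = G h.
Proof.
move=> FL GL FG; apply: (@eq_on_coordinates (regular_comodule H)) => // n b c bc i.
have -> : b i = \sum_j counit (b j) *: c j i.
  rewrite -[LHS]counitl /= -[Delta (b i)]/(rho (b i : regular_comodule H)).
  by rewrite (coordinates_tsum _ bc) //; bil.
rewrite (lin_sum _ FL) (lin_sum _ GL); apply: eq_bigr => j _.
by rewrite (lin_Z _ _ FL) (lin_Z _ _ GL) (FG _ _ bc.1).
Qed.
End CoordinateCalculus.

Section Module.
Variables (k : fieldType) (H : coquasi_hopf k) (A : comodule_algebra H).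
Variable gamma : {linear H -> A}.
Hypothesis gammaC : colinear (V := regular_comodule H) gamma.
Variable Si : {linear H -> H}.
Hypotheses (SK : cancel (@antipode k H) Si) (SiK : cancel Si (@antipode k H)).
Local Notation "'1H'" := (hone H).
Local Notation "h ** g" := (hmul h g) (at level 40, left associativity).
Local Notation S := (@antipode k H).

Lemma comatrix_antipode_inv (I : finType) (c : I -> I -> H) : comatrix c ->
  comatrix (fun i j => Si (c j i)).
Proof.
move=> cM; split=> i j; last by rewrite -counit_antipode SiK cM.2 eq_sym.
have := congr1 (fun t => \sw_(x, y <- t) Si y \ox Si x) (cM.1 j i).
rewrite -{1}[c j i]SiK Delta_antipode /sw2 tsum_tsum; last by bal.
rewrite tsum_sum_pure; last by bal.
move=> <-; rewrite -[LHS]tsum_pureE; apply: eq_tsum => x y.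
by rewrite tsum_pure ?SK //; bal.
Qed.

Lemma rho_gamma (I : finType) (d : I -> I -> H) s t : comatrix d ->
  rho (gamma (d s t)) = \sum_u gamma (d s u) \ox d u t.
Proof.
move=> dM; rewrite gammaC -[tsum _ _]/(sw2 (d s t) (fun x y => gamma x \ox y)).
by rewrite comatrix_sw2 //; bil.
Qed.

Section RactCoordinates.
Variable M : rel_hopf_module A.

Lemma coordinates_ract (I J : finType) (e : I -> M) (c : I -> I -> H)
    (a : J -> A) (u : J -> J -> H) : coordinates e c -> coordinates a u ->
  coordinates (fun p : I * J => ract (e p.1) (a p.2))
              (fun p q => c p.1 q.1 ** u p.2 q.2).
Proof.
move=> ec au; split=> [|p]; first exact: comatrix_mul ec.1 au.1.
rewrite rho_ract (coordinates_tsum _ ec); last by bil.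
under eq_bigr => j _ do (rewrite (coordinates_tsum _ au); last by bil).
exact: sum_pair.
Qed.

Lemma rho_ract_coordinates (I J : finType) (e : I -> M) (c : I -> I -> H)
    (f : J -> A) (v : J -> J -> H) i j : coordinates e c -> coordinates f v ->
  rho (ract (e i) (f j)) =
    \sum_i' \sum_j' ract (e i') (f j') \ox (c i' i ** v j' j).
Proof.
move=> ec fv; rewrite rho_ract (coordinates_tsum _ ec); last by bil.
by apply: eq_bigr => i' _; rewrite (coordinates_tsum _ fv) //; bil.
Qed.

End RactCoordinates.

Lemma gamma_coordinates (I : finType) (d : I -> I -> H) s :
  comatrix d -> coordinates (fun t => gamma (d s t)) d.
Proof. by move=> dM; split=> // t; rewrite rho_gamma. Qed.

Section RelativeHopfModule.
Variable M : rel_hopf_module A.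

Definition trace (m : M) : M :=
  \sw_(m0, m1 <- rho m) \Sw_(n1, n2 <- m1) beta n1 *: ract m0 (gamma (S n2)).

Lemma trace_linear : linear trace.
Proof. by rewrite /trace; lin. Qed.

(* In the Hopf case chi m h = m_0 gamma(S(m_1) h). *)
Definition chi (m : M) (h : H) : M :=
  \sw_(m0, m1 <- rho m) \Sw_(n1, n2 <- m1) \Sw_(h1, h2 <- h)
    omega_beta n1 h2 *: ract m0 (gamma (S n2 ** h1)).

Lemma chi_bilinear : bilinear chi.
Proof. by rewrite /chi; split=> ?; lin. Qed.
Hint Resolve chi_bilinear : bilin.

Section Coordinates.
Variables (I : finType) (e : I -> M) (c : I -> I -> H).
Hypothesis ec : coordinates e c.

Lemma trace_coordinates i :
  trace (e i) = \sum_j \sum_l beta (c j l) *: ract (e j) (gamma (S (c l i))).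
Proof.
rewrite /trace (coordinates_tsum _ ec); last by bil.
by apply: eq_bigr => j _; rewrite (comatrix_sw2 _ _ ec.1) //; bil.
Qed.

Lemma chi_coordinates (J : finType) (x : J -> J -> H) i s t : comatrix x ->
  chi (e i) (x s t) = \sum_j \sum_l \sum_u
    omega_beta (c j l) (x u t) *: ract (e j) (gamma (S (c l i) ** x s u)).
Proof.
move=> xM; rewrite /chi (coordinates_tsum _ ec); last by bil.
apply: eq_bigr => j _; rewrite (comatrix_sw2 _ _ ec.1); last by bil.
by apply: eq_bigr => l _; rewrite comatrix_sw2 //; bil.
Qed.
End Coordinates.

(** The coaction produces m_0 gamma(S(m_4)) (x) m_1 beta(m_2) S(m_3), and the right factor collapses
    by the antipode axiom. *)
Lemma trace_coinv (m : M) : trace m \in coinv_pred M.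
Proof.
rewrite unfold_in; apply/eqP.
apply: (eq_on_coordinates (F := fun m => rho (trace m))
  (G := fun m => trace m \ox 1H)) m; [|have := trace_linear; lin|].
  by apply: lin_lin; exact: trace_linear.
move=> n e c ec i; have cM := ec.1; have dM := comatrix_antipode cM.
rewrite (trace_coordinates ec) linear_sum pure_suml.
transitivity (\sum_j \sum_l \sum_j' \sum_l' beta (c j l) *:
    (ract (e j') (gamma (S (c l' i))) \ox (c j' j ** S (c l l')))).
  apply: eq_bigr => j _; rewrite linear_sum; apply: eq_bigr => l _.
  rewrite linearZ /= (rho_ract_coordinates _ _ ec (gamma_coordinates i dM)).
  einstein.
transitivity (\sum_j' \sum_l' \sum_j \sum_l beta (c j l) *:
    (ract (e j') (gamma (S (c l' i))) \ox (c j' j ** S (c l l')))).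
  einstein.
apply: eq_bigr => j' _; rewrite pure_suml; apply: eq_bigr => l' _.
rewrite (comatrix_beta cM (F := fun h => _ \ox h)); last by lin.
by rewrite pureZl.
Qed.

(** The coaction leaves m_1 (S(m_3) h) in the right factor with weight [omega_beta], which
    [omega_beta_assoc] reduces to a component of h. *)
Lemma chi_colinear (J : finType) (x : J -> J -> H) (m : M) s t : comatrix x ->
  rho (chi m (x s t)) = \sum_u chi m (x s u) \ox x u t.
Proof.
move=> xM; apply: (eq_on_coordinates (F := fun m => rho (chi m (x s t)))
  (G := fun m => \sum_u chi m (x s u) \ox x u t)) m; [by lin| |].
  move=> a m m'; rewrite scaler_sumr -big_split; apply: eq_bigr => u _.
  by rewrite (chi_bilinear.1 (x s u)) pureDl pureZl.
move=> n e c ec i; have cM := ec.1; have dM := comatrix_antipode cM.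
have eg : coordinates (fun p : 'I_n * J => gamma (S (c p.1 i) ** x s p.2))
    (fun p q => S (c q.1 p.1) ** x p.2 q.2).
  exact: (gamma_coordinates (i, s) (comatrix_mul dM xM)).
rewrite (chi_coordinates ec _ _ _ xM) linear_sum.
transitivity (\sum_j \sum_l \sum_u \sum_j' \sum_l' \sum_u' omega_beta (c j l) (x u t) *:
    (ract (e j') (gamma (S (c l' i) ** x s u')) \ox
       (c j' j ** (S (c l l') ** x u' u)))).
  apply: eq_bigr => j _; rewrite linear_sum; apply: eq_bigr => l _.
  rewrite linear_sum; apply: eq_bigr => u _; rewrite linearZ /=.
  rewrite (rho_ract_coordinates j (l, u) ec eg).
  transitivity (omega_beta (c j l) (x u t) *: \sum_j' \sum_l' \sum_u'
    (ract (e j') (gamma (S (c l' i) ** x s u')) \ox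
       (c j' j ** (S (c l l') ** x u' u)))); last by einstein.
  by congr (_ *: _); apply: eq_bigr => j' _; rewrite [RHS]sum_pair.
transitivity (\sum_j' \sum_l' \sum_u' ract (e j') (gamma (S (c l' i) ** x s u')) \ox
    \sum_j \sum_l \sum_u omega_beta (c j l) (x u t) *: (c j' j ** (S (c l l') ** x u' u))).
  transitivity (\sum_j' \sum_l' \sum_u' \sum_j \sum_l \sum_u omega_beta (c j l) (x u t) *:
    (ract (e j') (gamma (S (c l' i) ** x s u')) \ox
       (c j' j ** (S (c l l') ** x u' u)))); first by einstein_along [:: 3; 3; 3]%N.
  apply: eq_bigr => j' _; apply: eq_bigr => l' _; apply: eq_bigr => u' _.
  rewrite pure_sumr; apply: eq_bigr => j _; rewrite pure_sumr; apply: eq_bigr => l _.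
  by rewrite pure_sumr; apply: eq_bigr => u _; rewrite pureZr.
under eq_bigr => j' _ do under eq_bigr => l' _ do under eq_bigr => u' _ do
  rewrite (omega_beta_assoc cM xM).
under [RHS]eq_bigr => u _ do rewrite (chi_coordinates ec _ _ _ xM).
transitivity (\sum_j' \sum_l' \sum_u' \sum_u omega_beta (c j' l') (x u' u) *:
   (ract (e j') (gamma (S (c l' i) ** x s u')) \ox x u t)).
  apply: eq_bigr => j' _; apply: eq_bigr => l' _; apply: eq_bigr => u' _.
  by rewrite pure_sumr; apply: eq_bigr => u _; rewrite pureZr.
transitivity (\sum_u \sum_j' \sum_l' \sum_u' omega_beta (c j' l') (x u' u) *:
   (ract (e j') (gamma (S (c l' i) ** x s u')) \ox x u t)).
  by einstein_along [:: 3]%N.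
apply: eq_bigr => u _; rewrite pure_suml; apply: eq_bigr => j' _.
rewrite pure_suml; apply: eq_bigr => l' _.
by rewrite pure_suml; apply: eq_bigr => u' _; rewrite pureZl.
Qed.

(** The antipode axiom for [alpha] turns the argument of [gamma] into 1; the remaining scalars
    cancel by [omega_beta_alpha]. *)
Lemma chi_alpha (m : M) : gamma 1H = aone A ->
  \sw_(m0, m1 <- rho m) \Sw_(h1, h2 <- m1) alpha h1 *: chi m0 h2 = m.
Proof.
move=> gamma1; apply: (eq_on_coordinates
  (F := fun m => \sw_(m0, m1 <- rho m) \Sw_(h1, h2 <- m1) alpha h1 *: chi m0 h2)
  (G := id)) m; [by lin|by []|].
move=> n e c ec i; have cM := ec.1.
rewrite (coordinates_tsum _ ec); last by bil.
under eq_bigr => j _ do (rewrite comatrix_sw2 //; last by bil).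
under eq_bigr => j _ do under eq_bigr => l _ do rewrite (chi_coordinates ec _ _ _ cM).
transitivity (\sum_j \sum_l \sum_u omega_beta (c j l) (c u i) *:
   \sum_a \sum_b alpha (c a b) *: ract (e j) (gamma (S (c l a) ** c b u))).
  by einstein_along [:: 2; 2; 2]%N.
under eq_bigr => j _ do under eq_bigr => l _ do under eq_bigr => u _ do
  (rewrite (comatrix_alpha cM (F := fun h => ract (e j) (gamma h)));
   [rewrite gamma1 ract1|by lin]).
transitivity (\sum_j (\sum_l \sum_u alpha (c l u) * omega_beta (c j l) (c u i)) *: e j).
  by einstein.
under eq_bigr => j _ do rewrite (omega_beta_alpha cM).
exact: sum_deltar.
Qed.

(* In the Hopf case theta m l = m_0 gamma(S(m_1) S^-1(l_1)) l_0. *)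
Definition theta (m : M) (l : A) : M :=
  \sw_(l0, l1 <- rho l) \Sw_(n1, n2 <- l1)
    beta (Si n1) *: ract (chi m (Si n2)) l0.

Lemma theta_bilinear : bilinear theta.
Proof. by rewrite /theta; split=> ?; lin. Qed.
Hint Resolve theta_bilinear : bilin.

(** The action of the functional omega_beta(-, r) on [H]; it absorbs the associator that appears
    when [theta m l] is multiplied by an element of [A]. *)
Definition omega_beta_act (g r : H) : H := \Sw_(g1, g2 <- g) omega_beta g2 r *: g1.

Lemma omega_beta_act_bilinear : bilinear omega_beta_act.
Proof. by rewrite /omega_beta_act; split=> ?; lin. Qed.
Hint Resolve omega_beta_act_bilinear : bilin.

Lemma comatrix_omega_beta_act (I : finType) (d : I -> I -> H) i j r : comatrix d ->
  omega_beta_act (d i j) r = \sum_l omega_beta (d l j) r *: d i l.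
Proof. by move=> dM; rewrite /omega_beta_act comatrix_sw2 //; bil. Qed.

(* A map with theta m l * r = Phi m (can (l (x) r)); in the Hopf case
   Phi m a h = m_0 gamma(S(m_1) h S^-1(a_1)) a_0.  The element
   S^-1(a_2 S(h_1)) is kept as it stands since S is only antimultiplicative up to a
   twist. *)
Definition Phi (m : M) (a : A) (h : H) : M :=
  \sw_(a0, a' <- rho a) \Sw_(a1, a2 <- a') \Sw_(h1, h2, h3 <- h)
    omega_alpha a1 h2 *: ract (chi m (omega_beta_act (Si (a2 ** S h1)) h3)) a0.

Lemma Phi_bilinear m : bilinear (Phi m).
Proof. by rewrite /Phi; split=> ?; lin. Qed.

Section Coordinates.
Variables (X : finType) (a : X -> A) (u : X -> X -> H).
Hypothesis au : coordinates a u.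
Variable m : M.
(** The coefficients of [a] are written as S of the comatrix [d], so that the antipode axioms apply
    to [d] and S^-1 disappears from the formulas. *)
Let d x y := Si (u y x).
Let dM : comatrix d.
Proof. exact: comatrix_antipode_inv au.1. Qed.
Let uE x y : u x y = S (d y x).
Proof. by rewrite /d SiK. Qed.

Let auS : coordinates a (fun x y => S (d y x)).
Proof. have -> // : (fun x y => S (d y x)) = u.
by apply/funext => x; apply/funext => y; rewrite uE. Qed.

Lemma theta_coordinates x :
  theta m (a x) = \sum_y \sum_q beta (d q y) *: ract (chi m (d x q)) (a y).
Proof.
rewrite /theta (coordinates_tsum _ au); last by bil.
by apply: eq_bigr => y _; rewrite (comatrix_sw2 _ _ au.1) //; bil.
Qed.

Lemma chi_comatrix (J : finType) (x : J -> J -> H) s : comatrix x ->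
  coordinates (fun t => chi m (x s t)) x.
Proof. by move=> xM; split=> // t; rewrite chi_colinear. Qed.

(** As for [trace_coinv]: since [chi m] is colinear, the right factor is d_1 beta(d_2) S(d_3) with d
    = S^-1(l_1). *)
Lemma theta_coinv_coordinates x : theta m (a x) \in coinv_pred M.
Proof.
rewrite unfold_in; apply/eqP; rewrite theta_coordinates linear_sum pure_suml.
transitivity (\sum_y \sum_q \sum_q' \sum_y' beta (d q y) *:
    (ract (chi m (d x q')) (a y') \ox (d q' q ** S (d y y')))).
  apply: eq_bigr => y _; rewrite linear_sum; apply: eq_bigr => q _.
  rewrite linearZ /= (rho_ract_coordinates q y (chi_comatrix x dM) auS).
  by einstein.
transitivity (\sum_y' \sum_q' \sum_q \sum_y beta (d q y) *:
    (ract (chi m (d x q')) (a y') \ox (d q' q ** S (d y y')))).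
  by einstein_along [:: 3; 2]%N.
apply: eq_bigr => y' _; rewrite pure_suml; apply: eq_bigr => q' _.
rewrite (comatrix_beta dM (F := fun h => _ \ox h)); last by lin.
by rewrite pureZl.
Qed.

Section Action.
Variables (Z : finType) (b : Z -> A) (w : Z -> Z -> H).
Hypothesis bw : coordinates b w.

Lemma ract_theta_coordinates x z : ract (theta m (a x)) (b z) =
  \sum_y \sum_z' ract (chi m (omega_beta_act (Si (u y x)) (w z' z))) (amul (a y) (b z')).
Proof.
rewrite theta_coordinates.
rewrite (lin_sum _ ((ract_bilinear M).1 (b z))).
transitivity (\sum_y \sum_q beta (d q y) *: \sum_q' \sum_y' \sum_z'
   omega (d q' q) (S (d y y')) (w z' z) *:
     ract (chi m (d x q')) (amul (a y') (b z'))).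
  apply: eq_bigr => y _; rewrite (lin_sum _ ((ract_bilinear M).1 (b z))).
  apply: eq_bigr => q _; rewrite (bilZl (ract_bilinear M)); congr (_ *: _).
  rewrite ractA (coordinates_tsum _ (chi_comatrix x dM)); last by bil.
  apply: eq_bigr => q' _; rewrite (coordinates_tsum _ auS); last by bil.
  by apply: eq_bigr => y' _; rewrite (coordinates_tsum _ bw) //; bil.
transitivity (\sum_y' \sum_z' \sum_q' (\sum_q \sum_y beta (d q y) *
   omega (d q' q) (S (d y y')) (w z' z)) *:
     ract (chi m (d x q')) (amul (a y') (b z'))).
  by einstein_along [:: 3; 3; 2; 1]%N.
apply: eq_bigr => y _; apply: eq_bigr => z' _.
rewrite -/(d x y) comatrix_omega_beta_act //.
rewrite (lin_sum (f := fun h => ract (chi m h) (amul (a y) (b z')))); last by lin.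
apply: eq_bigr => q' _; rewrite (bilZr chi_bilinear) (bilZl (ract_bilinear M)).
by rewrite comatrix_omega_beta.
Qed.
End Action.

Lemma Phi_coordinates (J : finType) (x : J -> J -> H) i s t : comatrix x ->
  Phi m (a i) (x s t) = \sum_j \sum_l \sum_v \sum_v'
    omega_alpha (u j l) (x v v') *:
      ract (chi m (omega_beta_act (Si (u l i ** S (x s v))) (x v' t))) (a j).
Proof.
move=> xM; rewrite /Phi (coordinates_tsum _ au); last by bil.
apply: eq_bigr => j _; rewrite (comatrix_sw2 _ _ au.1); last by bil.
by apply: eq_bigr => l _; rewrite comatrix_sw3 //; move=> *; lin.
Qed.
End Coordinates.

Lemma theta_coinv (m : M) l : theta m l \in coinv_pred M.
Proof.
rewrite unfold_in; apply/eqP.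
apply: (eq_on_coordinates (F := fun l => rho (theta m l))
  (G := fun l => theta m l \ox 1H)) l; [by lin|by lin|].
by move=> n b c bc i; have /eqP := theta_coinv_coordinates bc m i.
Qed.

(** The value of [can] on a pure tensor, as a k-bilinear map: each argument can then be checked on
    coordinates separately. *)
Definition can_expansion (a b : A) : A \ox H :=
  \sw_(a0, a1 <- rho a) \sw_(b0, b' <- rho b) \Sw_(b1, b2, b3, b4 <- b')
    omegaV a1 (beta b2 *: b1) (S b3) *: (amul a0 b0 \ox b4).

Lemma can_coordinates (X Z : finType) (a : X -> A) (u : X -> X -> H)
    (b : Z -> A) (w : Z -> Z -> H) x z :
  coordinates a u -> coordinates b w ->
  can_expansion (a x) (b z) = \sum_y \sum_z1 \sum_z2
    omegaV_beta (u y x) (w z1 z2) *: (amul (a y) (b z1) \ox w z2 z).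
Proof.
move=> au bw; have wM := bw.1; have [_ w2 _] := omegaV_trilinear H.
rewrite /can_expansion (coordinates_tsum _ au); last by bil.
apply: eq_bigr => y _; rewrite (coordinates_tsum _ bw); last by bil.
apply: eq_bigr => z1 _; rewrite (comatrix_sw4 _ _ wM); try by move=> *; lin.
under [RHS]eq_bigr => z2 _ do rewrite (comatrix_omegaV_beta wM).
transitivity (\sum_p \sum_q \sum_z2 (beta (w p q) * omegaV (u y x) (w z1 p) (S (w q z2)))
  *: (amul (a y) (b z1) \ox w z2 z)); last by einstein.
apply: eq_bigr => p _; apply: eq_bigr => q _; apply: eq_bigr => z2 _.
by rewrite (lin_Z (W := k^o) _ _ (w2 _ _)).
Qed.

(** After expansion, [omegaV_beta_assoc] simplifies the argument of S^-1 and
    [omega_alpha_omegaV_beta] cancels the scalars, leaving the formula of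
    [ract_theta_coordinates]. *)
Lemma Phi_can_expansion (m : M) (l r : A) :
  \sw_(y, h <- can_expansion l r) Phi m y h = ract (theta m l) r.
Proof.
have PB := Phi_bilinear m.
apply: (eq_on_coordinates
  (F := fun l => \sw_(y, h <- can_expansion l r) Phi m y h)
  (G := fun l => ract (theta m l) r)) l; [|by lin|].
  by apply: lin_tsum_arg; [rewrite /can_expansion; lin|exact: bil_balanced].
move=> nx a u au x.
apply: (eq_on_coordinates
  (F := fun r => \sw_(y, h <- can_expansion (a x) r) Phi m y h)
  (G := fun r => ract (theta m (a x)) r)) r; [|by lin|].
  by apply: lin_tsum_arg; [rewrite /can_expansion; lin|exact: bil_balanced].
move=> nz b w bw z.
(* [T] isolates the argument [g] of S^-1; it is linear in [g], so sums and scalars can be moved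
   inside. *)
pose T y1 z1 g h := ract (chi m (omega_beta_act (Si g) h)) (amul (a y1) (b z1)).
have TL y1 z1 h : linear (fun g => T y1 z1 g h) by rewrite /T; lin.
rewrite (can_coordinates x z au bw) (ract_theta_coordinates au m bw).
transitivity (\sum_y \sum_z' \sum_z2 omegaV_beta (u y x) (w z' z2) *:
    \sum_y1 \sum_z1 \sum_y2 \sum_z3 \sum_v \sum_v'
      omega_alpha (u y1 y2 ** w z1 z3) (w v v') *:
        T y1 z1 ((u y2 y ** w z3 z') ** S (w z2 v)) (w v' z)).
  rewrite (tsum_sum (bil_balanced PB)); apply: eq_bigr => y _.
  rewrite (tsum_sum (bil_balanced PB)); apply: eq_bigr => z' _.
  rewrite (tsum_sum (bil_balanced PB)); apply: eq_bigr => z2 _.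
  rewrite (tsumZ (bil_balanced PB)) (tsum_pure (bil_balanced PB)); congr (_ *: _).
  have ab := coordinates_ract (M := regular_rhm A) au bw.
  rewrite (Phi_coordinates ab m (y, z') z2 z bw.1).
  rewrite [RHS]sum_pair; apply: eq_bigr => p _.
  by rewrite [RHS]sum_pair; apply: eq_bigr => q _.
transitivity (\sum_y1 \sum_z1 \sum_y2 \sum_z3 \sum_v \sum_v'
   omega_alpha (u y1 y2 ** w z1 z3) (w v v') *:
   T y1 z1 (\sum_y \sum_z' \sum_z2 omegaV_beta (u y x) (w z' z2) *:
     ((u y2 y ** w z3 z') ** S (w z2 v))) (w v' z)).
  transitivity (\sum_y1 \sum_z1 \sum_y2 \sum_z3 \sum_v \sum_v' \sum_y \sum_z' \sum_z2
    (omegaV_beta (u y x) (w z' z2) * omega_alpha (u y1 y2 ** w z1 z3) (w v v')) *: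
     T y1 z1 ((u y2 y ** w z3 z') ** S (w z2 v)) (w v' z)).
    by einstein_along [:: 3; 3; 3; 3; 3; 3]%N.
  apply: eq_bigr => y1 _; apply: eq_bigr => z1 _; apply: eq_bigr => y2 _.
  apply: eq_bigr => z3 _; apply: eq_bigr => v _; apply: eq_bigr => v' _.
  rewrite (lin_sum _ (TL _ _ _)) scaler_sumr; apply: eq_bigr => y _.
  rewrite (lin_sum _ (TL _ _ _)) scaler_sumr; apply: eq_bigr => z' _.
  rewrite (lin_sum _ (TL _ _ _)) scaler_sumr; apply: eq_bigr => z2 _.
  by rewrite (lin_Z _ _ (TL _ _ _)) scalerA mulrC.
(* The argument (l_1 r_1) S(r_3) is replaced by a component of l alone, and the factor r_3 no longer
   occurs under S^-1. *)
transitivity (\sum_y1 \sum_z1 \sum_y \sum_v' (\sum_y2 \sum_z3 \sum_v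
   omega_alpha (u y1 y2 ** w z1 z3) (w v v') * omegaV_beta (u y2 y) (w z3 v)) *:
     T y1 z1 (u y x) (w v' z)).
  transitivity (\sum_y1 \sum_z1 \sum_y2 \sum_z3 \sum_v \sum_v' \sum_y
    (omega_alpha (u y1 y2 ** w z1 z3) (w v v') * omegaV_beta (u y2 y) (w z3 v)) *:
     T y1 z1 (u y x) (w v' z)); last by einstein_along [:: 0; 0; 4; 3]%N.
  apply: eq_bigr => y1 _; apply: eq_bigr => z1 _; apply: eq_bigr => y2 _.
  apply: eq_bigr => z3 _; apply: eq_bigr => v _; apply: eq_bigr => v' _.
  rewrite (omegaV_beta_assoc au.1 bw.1) (lin_sum _ (TL _ _ _)) scaler_sumr.
  by apply: eq_bigr => y _; rewrite (lin_Z _ _ (TL _ _ _)) scalerA.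
apply: eq_bigr => y1 _; apply: eq_bigr => z1 _.
transitivity (\sum_y (y1 == y)%:R *: \sum_v' (z1 == v')%:R *:
   T y1 z1 (u y x) (w v' z)).
  under eq_bigr => y _ do under eq_bigr => v' _ do
    rewrite (omega_alpha_omegaV_beta au.1 bw.1).
  by einstein.
by rewrite sum_deltal sum_deltal.
Qed.

(** For a = 1 the element under S^-1 is S(h_1), [omega_alpha] reduces to [alpha], and
    [omega_beta_alpha] finishes. *)
Lemma Phi_one (m : M) h : Phi m (aone A) h = chi m h.
Proof.
have PL : linear (Phi m (aone A)) by have [] := Phi_bilinear m.
apply: (eq_on_comatrices PL (G := chi m)) h; first by lin.
move=> n x xM s t; rewrite /Phi rho_aone tsum_pure; last by bil.
rewrite sw2_one; last by bil.
rewrite comatrix_sw3 //; try by move=> *; lin.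
transitivity (\sum_q (\sum_v \sum_v' alpha (x v v') * omega_beta (x q v) (x v' t)) *:
   chi m (x s q)).
  under eq_bigr => v _ do under eq_bigr => v' _ do
    rewrite ract1 omega_alpha1l // hmul1l SK comatrix_omega_beta_act //
      (bil_sumr _ _ chi_bilinear).
  under eq_bigr => v _ do under eq_bigr => v' _ do under eq_bigr => q _ do
    rewrite (bilZr chi_bilinear).
  by einstein_along [:: 2]%N.
under eq_bigr => q _ do rewrite omega_beta_alpha //.
exact: sum_deltar.
Qed.

End RelativeHopfModule.
End Module.

(** * The equivalence *)

Lemma bijective_of (T U : Type) (f : T -> U) :
  injective f -> (forall y, exists x, f x = y) -> bijective f.
Proof.
move=> fI fS; exists (fun y => sval (cid (fS y))) => [x|y].
  by apply: fI; exact: svalP (cid (fS (f x))).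
exact: svalP (cid (fS y)).
Qed.

Lemma linear_inverse (R : pzRingType) (U V : lmodType R) (f : {linear U -> V}) :
  bijective f -> exists g : {linear V -> U}, cancel f g /\ cancel g f.
Proof.
case=> g fK gK; have gL := can2_linear fK gK.
pose gM := GRing.isLinear.Build R V U *:%R g gL.
by exists (HB.pack_for {linear V -> U} g gM).
Qed.

Lemma rmod_iso (R : pzRingType) (U V : rmod R) (f : hom U V) :
  bijective (f : {linear U -> V}) -> iso f.
Proof.
move=> /linear_inverse[g [fK gK]]; exists g.
by split; apply: linear_ext => x /=; rewrite ?fK ?gK.
Qed.

Section Homs.
Variables (k : fieldType) (H : coquasi_bialgebra k) (A : comodule_algebra H).

Lemma rhm_iso (M M' : rhm_category A) (f : hom M M') :
  bijective (f : rhm_hom M M') -> iso f.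
Proof.
move=> /linear_inverse[g [fK gK]].
have gC : colinear g.
  move=> y; rewrite -[in RHS](gK y) rhm_colinear tsum_tsum; last by bal.
  rewrite -[LHS]tsum_pureE; apply: eq_tsum => x z.
  by rewrite tsum_pure ?fK //; bal.
have gA m a : g (ract m a) = ract (g m) a.
  by rewrite -{1}[m]gK -rhm_ract fK.
exists (RhmHom gC gA).
by split; apply: rhm_hom_ext => x /=; rewrite ?fK ?gK.
Qed.

End Homs.

(** * Naturality of [chi] and [theta] in the module *)

Section Natural.
Variables (k : fieldType) (H : coquasi_hopf k) (A : comodule_algebra H).
Variables (gamma : {linear H -> A}) (Si : {linear H -> H}).
Variables (M M' : rel_hopf_module A) (f : rhm_hom M M').

Lemma rhm_hom_chi m h : f (chi gamma m h) = chi gamma (f m) h.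
Proof.
rewrite /chi rhm_colinear tsum_tsum; last by bal.
rewrite (tsum_comp_lin _ _ (linearP f)); apply: eq_tsum => m0 m1.
rewrite tsum_pure; last by bal.
rewrite /sw2 (tsum_comp_lin _ _ (linearP f)); apply: eq_tsum => n1 n2.
rewrite (tsum_comp_lin _ _ (linearP f)); apply: eq_tsum => h1 h2.
by rewrite linearZ /= rhm_ract.
Qed.

Lemma rhm_hom_theta m l : f (theta gamma Si m l) = theta gamma Si (f m) l.
Proof.
rewrite /theta (tsum_comp_lin _ _ (linearP f)); apply: eq_tsum => l0 l1.
rewrite /sw2 (tsum_comp_lin _ _ (linearP f)); apply: eq_tsum => n1 n2.
by rewrite linearZ /= rhm_ract rhm_hom_chi.
Qed.
End Natural.

(** * The k-linear structure of a right B-module *)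

Section ScalarsOfRightModules.
Variables (k : fieldType) (H : coquasi_bialgebra k) (A : comodule_algebra H).
Variable N : lmodType (coinv A)^c.

Fact coinv_scalar_subproof (x : k) : x *: aone A \in coinv_pred A.
Proof. by rewrite unfold_in linearZ /= rho_aone pureZl. Qed.
Definition coinv_scalar (x : k) : coinv A := Coinv (coinv_scalar_subproof x).

(* N with the action of k through the central scalars of B, which provides the
   k-linear structure required of the target of a balanced map. *)
Definition restricted_module : Type := N.
HB.instance Definition _ := GRing.Zmodule.on restricted_module.

Definition restricted_scale (x : k) (n : restricted_module) : restricted_module :=
  (coinv_scalar x : (coinv A)^c) *: (n : N).

Fact restricted_scaleA x y n :
  restricted_scale x (restricted_scale y n) = restricted_scale (x * y) n.
Proof.
rewrite /restricted_scale scalerA; congr (_ *: _); apply: val_inj => /=.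
by rewrite (bilZl (amul_bilinear A)) amul1l scalerA mulrC.
Qed.
Fact restricted_scale1 : left_id 1 restricted_scale.
Proof.
move=> n; rewrite /restricted_scale -[RHS]scale1r; congr (_ *: _).
by apply: val_inj; rewrite /= scale1r.
Qed.
Fact restricted_scaleDr : right_distributive restricted_scale +%R.
Proof. by move=> x n n'; rewrite /restricted_scale scalerDr. Qed.
Fact restricted_scaleDl n : {morph restricted_scale^~ n : x y / x + y}.
Proof.
move=> x y; rewrite /restricted_scale -scalerDl; congr (_ *: _).
by apply: val_inj; rewrite /= scalerDl.
Qed.
HB.instance Definition _ := GRing.Zmodule_isLmodule.Build k restricted_module
  restricted_scaleA restricted_scale1 restricted_scaleDr restricted_scaleDl.
End ScalarsOfRightModules.

(** * Bijectivity of the unit *)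

Section Unit.
Variables (k : fieldType) (H : coquasi_hopf k) (A : comodule_algebra H).
Variable gamma : {linear H -> A}.
Hypothesis gammaT : total_integral gamma.
Variable N : lmodType (coinv A)^c.

Let tr (a : A) : coinv A := Coinv (trace_coinv (M := regular_rhm A) gammaT.1 a).

Lemma trace_of_coinv (M : rel_hopf_module A) (m : coinv M) :
  trace gamma (m : M) = m.
Proof.
rewrite /trace tsum_coinv; last by bil.
by rewrite sw2_one ?beta1 ?antipode1 ?gammaT.2 ?ract1 ?scale1r //; bil.
Qed.

#[local] Hint Resolve ind_act_bilinear : bilin.

(** Coaction and action on N (x)_B A only concern [A], so the trace of n (x) a is n (x) tr(a) = n
    tr(a) (x) 1, because tr(a) lies in B. *)
Lemma trace_ind (t : ind_rhm N) :
  exists n : N, trace gamma t = (pure n (aone A) : ind_sort N).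
Proof.
have [tD tZ] := (linP _).1 (trace_linear gamma (M := ind_rhm N)).
elim/tens_ind: t => [n a|s t [n sn] [n' tn']|]; last first.
- exists 0; rewrite -(scale0r 0) tZ !scale0r; apply: (addrI (pure 0 (aone A))).
  by rewrite addr0 -pureDl addr0.
- by exists (n + n'); rewrite tD sn tn' pureDl.
exists (modB_act (tr a) n); rewrite pureB /lact amul1r /= /trace /= ind_rho_pure.
rewrite tsum_tsum; last by bil.
rewrite (@tsum_comp_lin _ _ _ _ _ _ _ _ _ _ (fun a : A => pure n a : ind_sort N));
  last by lin.
apply: eq_tsum => a0 a1; rewrite tsum_pure; last by bil.
rewrite /sw2 (@tsum_comp_lin _ _ _ _ _ _ _ _ _ _ (fun a : A => pure n a : ind_sort N)); last by lin.
by apply: eq_tsum => n1 n2; rewrite /= ind_act_pure pureZr.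
Qed.

Lemma trace_lact (b : coinv A) (a : A) : tr (lact b a) = b * tr a.
Proof.
apply: val_inj; rewrite /= /trace /= rho_lact.
rewrite tsum_tsum; last by bil.
rewrite (@tsum_comp_lin _ _ _ _ _ _ _ _ _ _ (amul (b : A))); last by lin.
apply: eq_tsum => a0 a1; rewrite tsum_pure; last by bil.
rewrite /sw2 (@tsum_comp_lin _ _ _ _ _ _ _ _ _ _ (amul (b : A))); last by lin.
apply: eq_tsum => n1 n2; rewrite /= lact_amul /lact.
by rewrite (bilZr (amul_bilinear A)).
Qed.

(** The map n (x) a |-> n tr(a), well defined over B by [trace_lact]. It is a left inverse of the
    unit since tr(1) = 1. *)
Definition ind_retract (t : ind_sort N) : restricted_module N :=
  tsum t (fun n a => (modB_act (tr a) n : restricted_module N)).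

Lemma ind_retract_balanced : balanced (@modB_act _ _ A N) (@lact _ _ A)
  (fun n a => (modB_act (tr a) n : restricted_module N)).
Proof.
have trL := trace_linear gamma (M := regular_rhm A).
have [trD trZ] := (linP _).1 trL.
split=> [n n' a|n a a'|x n a|b n a].
- exact: (scalerDr (tr a : (coinv A)^c) n n').
- apply: etrans (scalerDl (n : N) (tr a : (coinv A)^c) (tr a')).
  by rewrite /modB_act; congr (_ *: _); apply: val_inj; exact: trD.
- apply: etrans (esym (scalerA (coinv_scalar A x : (coinv A)^c) (tr a) (n : N))).
  rewrite /modB_act; congr (_ *: _); apply: val_inj => /=.
  by rewrite trZ (bilZr (amul_bilinear A)) amul1r.
by rewrite /modB_act scalerA trace_lact.
Qed.

(** Injectivity comes from [ind_retract]. For surjectivity, a coinvariant equals its own trace,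
    which has the form n (x) 1. *)
Lemma ind_unit_bijective : bijective (@ind_unit _ _ A N).
Proof.
apply: bijective_of => [n n' /(congr1 val) /= e|y].
  have := congr1 ind_retract e.
  rewrite /ind_retract !(tsum_pure ind_retract_balanced).
  have -> : tr (aone A) = 1.
    by apply: val_inj; exact: (trace_of_coinv (M := regular_rhm A) (coinv_one A)).
  by rewrite /modB_act !scale1r.
have [n en] := trace_ind (y : ind_rhm N); exists n; apply: val_inj => /=.
by rewrite -en; exact: (trace_of_coinv (M := ind_rhm N) y).
Qed.
End Unit.

(** * Bijectivity of the counit *)

Section Counit.
Variables (k : fieldType) (H : coquasi_hopf k) (A : comodule_algebra H).
Variables (gamma : {linear H -> A}) (Si : {linear H -> H}).
Hypotheses (gammaT : total_integral gamma) (SK : cancel (@antipode k H) Si)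
  (SiK : cancel Si (@antipode k H)).
Hypothesis can_surj : forall y : (A \ox H)%type, exists t : tensBA A, can t = y.

(** [t] is a preimage of 1 (x) h under [can], chosen independently of [M] and [m]; applying [Phi] to
    both sides gives the formula. *)
Lemma chi_theta (M : rel_hopf_module A) (m : M) h : exists t : tensBA A,
  chi gamma m h = \sw_(l, r <- t) ract (theta gamma Si m l) r.
Proof.
have [t et] := can_surj (aone A \ox h); exists t.
have PB := bil_balanced (Phi_bilinear gamma Si m).
rewrite -(Phi_one gamma SK) -[LHS](tsum_pure PB) -et -{1}(tsum_pureE t).
have canL : linear (fun t : tensBA A => \sw_(y, h <- can t) Phi gamma Si m y h).
  have cL : linear (@can _ _ A) := tsum_is_linear (can_balanced A).
  by move=> c u v; rewrite cL (tsum_is_linear PB).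
rewrite (tsum_comp_lin _ _ canL); apply: eq_tsum => l r.
by rewrite can_pure; exact: (Phi_can_expansion gammaT.1 SK SiK).
Qed.

Variable M : rel_hopf_module A.

(** By [chi_alpha] it suffices to reach the values of [chi]; by [chi_theta] these are sums of
    coinvariants acted on by [A]. *)
Lemma ind_counit_surjective (m : M) : exists t, ind_counit t = m.
Proof.
pose P (m : M) := exists t, ind_counit t = m.
have PD m1 m2 : P m1 -> P m2 -> P (m1 + m2).
  by move=> [t1 <-] [t2 <-]; exists (t1 + t2); rewrite linearD.
have P0 : P 0 by exists 0; rewrite linear0.
rewrite -/(P m) -(chi_alpha m gammaT.2).
apply: (big_ind P) => // -[m0 m1] _; apply: (big_ind P) => // -[h1 h2] _ /=.
have [t ->] := chi_theta m0 h2.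
have [u <-] : P (\sw_(l, r <- t) ract (theta gamma Si m0 l) r).
  apply: (big_ind P) => // -[l r] _ /=.
  exists (pure (Coinv (theta_coinv gammaT.1 SK SiK m0 l)) r : ind_sort (coinv M)).
  exact: ind_counit_pure.
by exists (alpha h1 *: u); rewrite linearZ.
Qed.

Lemma ind_counit_injective : injective (@ind_counit _ _ A M).
Proof.
have [u _ uK] := ind_unit_bijective gammaT (coinv M).
have chi0 (x : ind_rhm (coinv M)) h : ind_counit x = 0 -> chi gamma x h = 0.
  move=> x0; have [t ->] := chi_theta x h.
  rewrite /tsum big1 // => -[l r] _ /=.
  suff -> : theta gamma Si x l = 0.
    exact: (lin_0 ((ract_bilinear (ind_rhm (coinv M))).1 r)).
  have := uK (Coinv (theta_coinv gammaT.1 SK SiK x l)).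
  move: (u _) => n /(congr1 val) /= en.
  (* The counit sends n (x) 1 to n; by naturality it also sends this element, which is theta_x(l),
     to theta_0(l) = 0. *)
  have n0 : n = 0.
    apply: val_inj; rewrite /= -[LHS](ract1 (n : M)) -ind_counit_pure en.
    rewrite -[LHS]/(ind_counit_hom M (theta gamma Si x l)) rhm_hom_theta /= x0.
    exact: (lin_0 ((theta_bilinear gamma Si M).1 l)).
  rewrite -en n0; apply: (addrI (pure 0 (aone A))).
  by rewrite addr0 -pureDl addr0.
move=> x y /eqP; rewrite -subr_eq0 -linearB /= => /eqP xy0.
apply/eqP; rewrite -subr_eq0; apply/eqP; move: (x - y) xy0 => {x y} x x0.
(* Each [b i] is the image of [x] under a functional applied to its coaction. By colinearity the
   counit kills it, so [chi0] applies to every [b j] in the expansion of [b i] by [chi_alpha]. *)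
have [n [b [c [z [bc ex be]]]]] := coordinates_exist (x : ind_rhm (coinv M)).
rewrite ex big1 // => i _; suff -> : b i = 0 by rewrite scaler0.
have b0 j : ind_counit (b j) = 0.
  have [g ->] := be j.
  rewrite (tsum_comp_lin _ _ (linearP (@ind_counit _ _ A M))).
  transitivity (\sw_(y, z <- rho (ind_counit x)) g z *: y).
    rewrite (ind_counit_colinear (M := M)) [RHS]tsum_tsum; last by bal.
    by apply: eq_tsum => y t; rewrite linearZ tsum_pure //; bal.
  by rewrite x0 linear0 (tsum0 (bil_balanced _)) //; split=> ?; lin.
rewrite -(chi_alpha (b i) gammaT.2) (coordinates_tsum _ bc); last first.
  by have cB := chi_bilinear gamma (ind_rhm (coinv M)); bil.
rewrite big1 // => j _; rewrite (comatrix_sw2 _ _ bc.1); last first.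
  by have cB := chi_bilinear gamma (ind_rhm (coinv M)); bil.
by rewrite big1 // => l _; rewrite chi0 // scaler0.
Qed.
End Counit.

Theorem theorem32 (k : fieldType) (H : coquasi_hopf k)
    (hS : bijective (@antipode k H)) (A : comodule_algebra H)
    (h1 : exists gamma : {linear H -> A}, total_integral gamma)
    (h2 : forall y : (A \ox H)%type, exists t : tensBA A, can t = y) :
  inverse_equivalences (F := ind_functor A) (G := coinv_functor A)
    (ind_coinv_adjunction A).
Proof.
have [gamma gammaT] := h1; have [Si [SK SiK]] := linear_inverse hS.
split=> [N|M]; first by apply: rmod_iso; exact: ind_unit_bijective gammaT N.
apply: rhm_iso; apply: bijective_of;
  first exact: (ind_counit_injective gammaT SK SiK h2).
exact: (ind_counit_surjective gammaT SK SiK h2).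
Qed.
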